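(* Let $I$ be a nonzero proper monomial ideal of $E=K\langle e_1,\dots,e_n\rangle$ with linear quotients (with respect to a degree increasing order of $G(I)$, with respect to which the sets $\mathrm{set}(u)$ are formed). Then $$\mathrm{cx}_E(E/I)=\max\{|\mathrm{set}(u)|:u\in G(I)\}.$$ Moreover, if $K$ is an infinite field, then $$\mathrm{depth}_E(E/I)=\min\{n-|\mathrm{set}(u)|:u\in G(I)\}.$$
   Context: $K$ is a field, $E=K\langle e_1,\dots,e_n\rangle$ is the exterior algebra of a $K$-vector space with basis $e_1,\dots,e_n$, standard graded. A monomial is a product $e_\mu=e_{i_1}\cdots e_{i_d}$, $\mu=\{i_1<\dots<i_d\}\subseteq[n]=\{1,\dots,n\}$ (up to sign), with $\mathrm{supp}(e_\mu)=\mu$. A monomial ideal is an ideal generated by monomials; $G(I)$ is its unique minimal set of monomial generators. For an ideal $J$ and a monomial $u$, $J:(u)=\{x\in E:xu\in J\}$. $I$ has linear quotients with respect to an order $u_1,\dots,u_r$ of $G(I)$ if $0:(u_1)$ and $(u_1,\dots,u_{j-1}):(u_j)$, $j=2,\dots,r$, are each generated by a subset of $\{e_1,\dots,e_n\}$. The order is degree increasing if $\deg u_1\le\dots\le\deg u_r$. One sets $\mathrm{set}(u_j)=\{k\in[n]:e_k\in(u_1,\dots,u_{j-1}):(u_j)\}$ for $j\ge2$ and $\mathrm{set}(u_1)=\{k\in[n]:e_k\in0:(u_1)\}=\mathrm{supp}(u_1)$. Let $\mathcal{M}$ be the category of finitely generated $\mathbb{Z}$-graded left and right $E$-modules $M$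 satisfying $am=(-1)^{\deg a\deg m}ma$ for all homogeneous $a\in E$, $m\in M$. With $\beta_i(M)=\dim_K\mathrm{Tor}_i^E(M,K)$, the complexity of $M\in\mathcal{M}$ is $$\mathrm{cx}_E(M)=\inf\{c\in\mathbb{Z}:\beta_i(M)\le\alpha\, i^{c-1}\text{ for some }\alpha\in\mathbb{R}\text{ and for all }i\ge1\}.$$ A linear form $v\in E_1$ is $M$-regular if $0:_M(v)=vM$. A sequence $v_1,\dots,v_s$ of linear forms is an $M$-regular sequence if $v_1$ is $M$-regular, $v_i$ is $M/(v_1,\dots,v_{i-1})M$-regular for $i=2,\dots,s$, and $M/(v_1,\dots,v_s)M\ne0$. All maximal $M$-regular sequences have the same length, denoted $\mathrm{depth}_E(M)$. *)

(* Defs.v *)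
From HB Require Import structures.
From mathcomp Require Import all_boot all_order all_algebra all_field ring.
Set Implicit Arguments.
Unset Strict Implicit.
Unset Printing Implicit Defensive.
Import Order.TTheory GRing.Theory Num.Theory.
Local Open Scope ring_scope.

(** * The exterior algebra K<e_1, ..., e_n> *)

(* The K-vector space with basis (e_A), A ranging over the subsets of 'I_n;
   the element x is the sum of the x A *: e_A.  A named copy, because the
   library equips {ffun _ -> _} with a pointwise product. *)
Definition exterior (K : fieldType) (n : nat) := {ffun {set 'I_n} -> K^o}.
HB.instance Definition _ (K : fieldType) (n : nat) :=
  Vector.copy (exterior K n) {ffun {set 'I_n} -> K^o}.

Section Exterior.
Variables (K : fieldType) (n : nat).
Implicit Types (A B C D : {set 'I_n}) (x y z : exterior K n).

Definition ecoef x A : K := (x : {ffun {set 'I_n} -> K^o}) A.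

Definition ebasis A : exterior K n :=
  ([ffun B => (B == A)%:R] : {ffun {set 'I_n} -> K^o}).

Definition inversions A B : nat :=
  #|[set p : 'I_n * 'I_n | [&& p.1 \in A, p.2 \in B & (p.2 < p.1)%N]]|.

(* For disjoint A and B, e_A e_B = (-1)^(inversions A B) e_(A u B). *)
Definition emul x y : exterior K n :=
  ([ffun C : {set 'I_n} => \sum_(A : {set 'I_n} | A \subset C)
      (-1) ^+ inversions A (C :\: A) * ecoef x A * ecoef y (C :\: A)]
    : {ffun {set 'I_n} -> K^o}).

Lemma ecoefP x y : (forall A, ecoef x A = ecoef y A) -> x = y.
Proof. by move=> e; apply/ffunP => A; exact: e. Qed.

Lemma ecoef_ebasis A B : ecoef (ebasis A) B = (B == A)%:R.
Proof. by rewrite /ecoef ffunE. Qed.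

Lemma ecoefM x y C : ecoef (emul x y) C =
  \sum_(A : {set 'I_n} | A \subset C)
      (-1) ^+ inversions A (C :\: A) * ecoef x A * ecoef y (C :\: A).
Proof. by rewrite /ecoef ffunE. Qed.

Lemma ecoefD x y A : ecoef (x + y) A = ecoef x A + ecoef y A.
Proof. by rewrite /ecoef ffunE. Qed.

Lemma ecoefZ (a : K) x A : ecoef (a *: x) A = a * ecoef x A.
Proof. by rewrite /ecoef ffunE. Qed.

Lemma inversionsUl A B C : [disjoint A & B] ->
  inversions (A :|: B) C = (inversions A C + inversions B C)%N.
Proof.
move=> dAB; rewrite /inversions -cardsUI; set X := (X in (_ + #|X|)%N).
have -> : #|X| = 0%N.
  apply: eq_card0 => p; rewrite !inE; apply/negP => /andP[/and3P[pA _ _]].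
  by case/and3P => pB _ _; have := disjointFr dAB pA; rewrite pB.
rewrite addn0; apply: eq_card => p; rewrite !inE.
by case: (p.1 \in A); case: (p.1 \in B); rewrite /= ?andbF ?orbF ?orbb.
Qed.

Lemma inversionsUr A B C : [disjoint B & C] ->
  inversions A (B :|: C) = (inversions A B + inversions A C)%N.
Proof.
move=> dBC; rewrite /inversions -cardsUI; set X := (X in (_ + #|X|)%N).
have -> : #|X| = 0%N.
  apply: eq_card0 => p; rewrite !inE; apply/negP => /andP[/and3P[_ pB _]].
  by case/and3P => _ pC _; have := disjointFr dBC pB; rewrite pC.
rewrite addn0; apply: eq_card => p; rewrite !inE.
by case: (p.1 \in A); case: (p.2 \in B); case: (p.2 \in C);
  rewrite /= ?andbF ?orbF ?orbb.
Qed.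

Lemma inversions0l A : inversions set0 A = 0%N.
Proof. by apply: eq_card0 => p; rewrite !inE. Qed.

Lemma inversions0r A : inversions A set0 = 0%N.
Proof. by apply: eq_card0 => p; rewrite !inE andbF. Qed.

Lemma setD_trans A B C : A \subset B -> B \subset C ->
  C :\: A = (B :\: A) :|: (C :\: B).
Proof.
move=> sAB sBC; apply/setP => i; rewrite !inE.
have /implyP := subsetP sAB i; have /implyP := subsetP sBC i.
by case: (i \in A); case: (i \in B); case: (i \in C).
Qed.

Lemma disjoint_setDD A B C : [disjoint B :\: A & C :\: B].
Proof. by apply/pred0P => i; rewrite !inE; case: (i \in B); rewrite ?andbF. Qed.

Lemma emulA : associative emul.
Proof.
move=> x y z; apply: ecoefP => C; rewrite !ecoefM.
under [RHS]eq_bigr => B _ do rewrite ecoefM mulr_sumr mulr_suml.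
rewrite [RHS](exchange_big_dep (fun A : {set 'I_n} => A \subset C)) /=; last first.
  by move=> B A sBC sAB; exact: subset_trans sAB sBC.
apply: eq_bigr => A sAC; rewrite ecoefM mulr_sumr.
rewrite [RHS](reindex_onto (fun D => A :|: D) (fun B => B :\: A)) /=; last first.
  by move=> B /andP[_ sAB]; rewrite -{2}(setID B A) (setIidPr sAB).
have eqD D : D \subset C :\: A -> (A :|: D) :\: A = D.
  move=> sD; apply/setP => i; rewrite !inE; have := subsetP sD i; rewrite !inE.
  by case: (i \in A); case: (i \in D) => // /(_ isT).
apply: eq_big => [D | D sD].
  apply/idP/idP => [sD | /andP[/andP[sDC _] /eqP <-]]; last exact: setSD.
  rewrite subsetUl eqD // eqxx !andbT subUset sAC.
  by apply: subset_trans sD _; exact: subsetDl.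
have sADC : A :|: D \subset C.
  by rewrite subUset sAC (subset_trans sD) ?subsetDl.
have sAAD : A \subset A :|: D by exact: subsetUl.
have eC : C :\: A :\: D = C :\: (A :|: D) by rewrite setDDl.
have dAD : [disjoint A & D].
  rewrite disjoint_sym; apply/pred0P => i /=; apply/negP => /andP[iD iA].
  by have := subsetP sD i iD; rewrite !inE iA.
have := disjoint_setDD A (A :|: D) C; have := setD_trans sAAD sADC.
rewrite eC (eqD D sD) => -> /inversionsUr ->; rewrite inversionsUl // !exprD.
by ring.
Qed.

Lemma emul1l : left_id (ebasis set0) emul.
Proof.
move=> x; apply: ecoefP => C; rewrite ecoefM (bigD1 set0) ?sub0set //=.
rewrite big1 => [|A /andP[_ /negPf nA]]; last first.
  by rewrite ecoef_ebasis nA mulr0 mul0r.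
by rewrite ecoef_ebasis eqxx inversions0l setD0 addr0 !mul1r.
Qed.

Lemma emul1r : right_id (ebasis set0) emul.
Proof.
move=> x; apply: ecoefP => C; rewrite ecoefM (bigD1 C) //=.
rewrite big1 => [|A /andP[sAC nA]]; last first.
  have /negPf nCA : ~~ (C \subset A).
    by apply: contraNN nA => sCA; rewrite eqEsubset sAC.
  by rewrite ecoef_ebasis setD_eq0 nCA mulr0.
by rewrite setDv ecoef_ebasis eqxx inversions0r addr0 mul1r mulr1.
Qed.

Lemma emulDl : left_distributive emul +%R.
Proof.
move=> x y z; apply: ecoefP => C; rewrite ecoefD !ecoefM -big_split /=.
by apply: eq_bigr => A _; rewrite ecoefD; ring.
Qed.

Lemma emulDr : right_distributive emul +%R.
Proof.
move=> x y z; apply: ecoefP => C; rewrite ecoefD !ecoefM -big_split /=.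
by apply: eq_bigr => A _; rewrite ecoefD; ring.
Qed.

Lemma ebasis_neq0 A : ebasis A != 0.
Proof.
apply/eqP => /(congr1 (fun x => ecoef x A)).
by rewrite ecoef_ebasis eqxx /ecoef ffunE => /eqP; rewrite oner_eq0.
Qed.

HB.instance Definition _ := GRing.Zmodule_isNzRing.Build (exterior K n)
  emulA emul1l emul1r emulDl emulDr (ebasis_neq0 set0).

Lemma escalerAl (a : K) x y : a *: (x * y) = (a *: x) * y.
Proof.
apply: ecoefP => C; rewrite ecoefZ !ecoefM mulr_sumr.
by apply: eq_bigr => A _; rewrite ecoefZ; ring.
Qed.

HB.instance Definition _ :=
  GRing.Lmodule_isLalgebra.Build K (exterior K n) escalerAl.

Lemma escalerAr (a : K) x y : a *: (x * y) = x * (a *: y).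
Proof.
apply: ecoefP => C; rewrite ecoefZ !ecoefM mulr_sumr.
by apply: eq_bigr => A _; rewrite ecoefZ; ring.
Qed.

HB.instance Definition _ :=
  GRing.Lalgebra_isAlgebra.Build K (exterior K n) escalerAr.

HB.instance Definition _ := Algebra_isFalgebra.Build K (exterior K n).

Lemma ebasisM A B : ebasis A * ebasis B =
  if [disjoint A & B] then (-1) ^+ inversions A B *: ebasis (A :|: B) else 0.
Proof.
apply: ecoefP => C; rewrite ecoefM.
have [sAC | nAC] := boolP (A \subset C); last first.
  rewrite big1 => [|D sDC]; last first.
    have /negPf nDA : D != A by apply: contraNneq nAC => <-.
    by rewrite ecoef_ebasis nDA mulr0 mul0r.
  case: ifP => _; last by rewrite /ecoef ffunE.
  rewrite ecoefZ ecoef_ebasis; case: eqP => [eC|_]; last by rewrite mulr0.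
  by rewrite eC subsetUl in nAC.
rewrite (bigD1 A) //= big1 => [|D /andP[_ /negPf nDA]]; last first.
  by rewrite ecoef_ebasis nDA mulr0 mul0r.
rewrite addr0 !ecoef_ebasis eqxx mulr1.
have [dAB | ndAB] := ifPn; last first.
  rewrite [RHS]/ecoef ffunE; case: eqP => [eB|_]; last by rewrite mulr0.
  case/negP: ndAB; rewrite -eB; apply/pred0P => i; rewrite !inE.
  by case: (i \in A).
rewrite ecoefZ ecoef_ebasis; have [<- | nB] := eqVneq (C :\: A) B.
  by rewrite -[X in X :|: _](setIidPr sAC) setID eqxx.
have [eC | _] := eqVneq C (A :|: B); last by rewrite !mulr0.
case/eqP: nB; rewrite eC; apply/setP => i; rewrite !inE.
by case: (boolP (i \in A)) => //= /(disjointFr dAB) ->.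
Qed.

Definition evar (i : 'I_n) : exterior K n := ebasis [set i].

(* e_{i_1} ... e_{i_d} for A = {i_1 < ... < i_d}: enum lists 'I_n increasingly *)
Definition emono A : exterior K n := \prod_(i <- enum A) evar i.

Lemma evar_sqr i : evar i * evar i = 0.
Proof. by rewrite ebasisM disjoints1 !inE eqxx. Qed.

Lemma evar_anticomm i j : evar i * evar j = - (evar j * evar i).
Proof.
have [-> | nij] := eqVneq i j; first by rewrite evar_sqr oppr0.
rewrite !ebasisM !disjoints1 !inE [j == i]eq_sym (negPf nij) /= setUC -scaleNr.
congr (_ *: _); rewrite /inversions.
have c (a b : 'I_n) : #|[set p : 'I_n * 'I_n |
    [&& p.1 \in [set a], p.2 \in [set b] & (p.2 < p.1)%N]]| = (b < a)%N.
  have [lt_ba | le_ab] := ltnP b a.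
    rewrite -[RHS](cards1 (a, b)); apply: eq_card => -[p q]; rewrite !inE /=.
    by rewrite xpair_eqE; case: eqP => //= ->; case: eqP => //= ->.
  rewrite [LHS]eq_card0 // => -[p q]; rewrite !inE /=; apply/negP.
  by case/and3P => /eqP -> /eqP ->; rewrite ltnNge le_ab.
rewrite !c; case: ltngtP => [_|_|/val_inj e]; rewrite ?expr1 ?expr0 ?opprK //.
by rewrite e eqxx in nij.
Qed.

Lemma emonoE A : emono A = ebasis A.
Proof.
have lt_tr : transitive (fun i j : 'I_n => (i < j)%N).
  by move=> ? ? ?; exact: ltn_trans.
have sA : sorted (fun i j : 'I_n => (i < j)%N) (enum A).
  have : sorted ltn (map val (enum 'I_n)).
    by rewrite val_enum_ord iota_ltn_sorted.
  by rewrite sorted_map [enum A]/enum_mem -enumT; exact: sorted_filter.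
rewrite -{2}(set_enum A) /emono; elim: (enum A) sA => [_ | i s IHs sA].
  by rewrite big_nil; congr ebasis; apply/setP => i; rewrite !inE.
rewrite big_cons {}IHs; last exact: path_sorted sA.
have /allP lt_i := order_path_min lt_tr sA.
rewrite ebasisM disjoints1 inE; have [/lt_i|_] := boolP (i \in s).
  by rewrite ltnn.
rewrite /inversions [#|_|]eq_card0 => [|[p q]]; last first.
  rewrite !inE /=; apply/negP => /and3P[/eqP -> /lt_i].
  by move=> ltq /(ltn_trans ltq); rewrite ltnn.
by rewrite expr0 scale1r; congr ebasis; apply/setP => j; rewrite !inE.
Qed.

(* the projection E -> E/(e_1, ..., e_n) = K *)
Definition eaug (x : exterior K n) : K := ecoef x set0.

(** * Monomial ideals and linear quotients *)

(* the two-sided ideal generated by s *)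
Definition ideal_gen (s : seq (exterior K n)) : {vspace exterior K n} :=
  (fullv * <<s>> * fullv)%VS.

(* J : (u) = {x | x * u \in J} *)
Definition colon (J : {vspace exterior K n}) (u : exterior K n) :=
  (amulr u @^-1: J)%VS.

Record ideal := Ideal {
  ideal_carrier :> {vspace exterior K n};
  ideal_mull : forall a x, x \in ideal_carrier -> a * x \in ideal_carrier;
  ideal_mulr : forall a x, x \in ideal_carrier -> x * a \in ideal_carrier }.

(* Monomials are given, up to sign, by their supports. *)
Definition mono_ideal (s : seq {set 'I_n}) : {vspace exterior K n} :=
  ideal_gen [seq emono A | A <- s].

Definition is_monomial_ideal (I : ideal) : Prop :=
  exists s : seq {set 'I_n}, I = mono_ideal s :> {vspace exterior K n}.

(* G is a minimal set of monomial generators of I *)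
Definition min_mono_gens (I : ideal) (G : {set {set 'I_n}}) : bool :=
  minset (fun H : {set {set 'I_n}} => mono_ideal (enum H) == I) G.

(* (u_1, ..., u_(j-1)) : (u_j) for u = u_j in the list us; this is 0 : (u_1)
   when u is the first element *)
Definition prefix_colon (us : seq {set 'I_n}) (u : {set 'I_n}) :=
  colon (mono_ideal (take (index u us) us)) (emono u).

Definition linear_quotients (us : seq {set 'I_n}) : Prop :=
  forall u, u \in us -> exists S : {set 'I_n},
    prefix_colon us u = ideal_gen [seq evar k | k <- enum S].

Definition degree_increasing (us : seq {set 'I_n}) : bool :=
  sorted leq [seq #|u| | u : {set 'I_n} <- us].

Definition lq_set (us : seq {set 'I_n}) (u : {set 'I_n}) : {set 'I_n} :=
  [set k | evar k \in prefix_colon us u].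

End Exterior.

From mathcomp Require Import ring_quotient.
From mathcomp Require Import boolp classical_sets cardinality reals ereal
  constructive_ereal.
Local Open Scope quotient_scope.

(** * The left module E/I *)

Section QuotientModule.
Variables (K : fieldType) (n : nat) (I : ideal K n).

Definition equot : Type := Quotient.quot (pred_of_vspace I).
HB.instance Definition _ := GRing.Zmodule.on equot.

Definition epi (x : exterior K n) : equot := \pi_equot x.
Definition equot_scale (a : exterior K n) (m : equot) : equot := epi (a * repr m).


Lemma epi_eq x y : (epi x == epi y) = (x - y \in I).
Proof. by rewrite /epi -Quotient.idealrBE. Qed.

Lemma epiD x y : epi (x + y) = epi x + epi y.
Proof. exact: (@pi_addr _ _ _ _ _ (Quotient.quot (pred_of_vspace I)) x y). Qed.

Lemma epiK (m : equot) : epi (repr m) = m.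
Proof. exact: reprK. Qed.

Lemma equot_scaleE a x : equot_scale a (epi x) = epi (a * x).
Proof.
apply/eqP; rewrite epi_eq -mulrBr; apply: ideal_mull.
by rewrite -epi_eq epiK.
Qed.

Lemma equot_scaleA a b m :
  equot_scale a (equot_scale b m) = equot_scale (a * b) m.
Proof. by rewrite -[m]epiK !equot_scaleE mulrA. Qed.

Lemma equot_scale1 : left_id 1 equot_scale.
Proof. by move=> m; rewrite -[m]epiK equot_scaleE mul1r. Qed.

Lemma equot_scaleDr : right_distributive equot_scale +%R.
Proof.
move=> a m p; rewrite -[m]epiK -[p]epiK.
by rewrite -epiD !equot_scaleE mulrDr epiD.
Qed.

Lemma equot_scaleDl m : {morph equot_scale^~ m : a b / a + b}.
Proof. by move=> a b; rewrite -[m]epiK !equot_scaleE mulrDl epiD. Qed.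

HB.instance Definition _ := GRing.Zmodule_isLmodule.Build (exterior K n) equot
  equot_scaleA equot_scale1 equot_scaleDr equot_scaleDl.

End QuotientModule.

(** * Betti numbers and complexity *)

Section Complexity.
Variables (K : fieldType) (n : nat).
Local Notation E := (exterior K n).

(* ... -> E^(rk 2) -> E^(rk 1) -> E^(rk 0) -> M -> 0, a resolution of the left
   module M by free modules of finite rank; row vectors form left modules, on
   which matrices act on the right. *)
Record free_resolution (M : lmodType E) := FreeResolution {
  rk : nat -> nat;
  bd : forall i, 'M[E]_(rk i.+1, rk i);
  aug : {linear 'rV[E]_(rk 0) -> M};
  aug_onto : forall m, exists x, aug x = m;
  aug_exact : forall x, aug x = 0 <-> exists y, x = y *m bd 0;
  bd_exact : forall i (x : 'rV[E]_(rk i.+1)),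
    x *m bd i = 0 <-> exists y, x = y *m bd i.+1 }.

(* the matrix over K of the differential K (x)_E bd i *)
Definition bdK (M : lmodType E) (F : free_resolution M) (i : nat) :
    'M[K]_(rk F i.+1, rk F i) :=
  map_mx (@eaug K n) (bd F i).

(* dim_K of the i-th homology of K (x)_E F *)
Definition dim_tor (M : lmodType E) (F : free_resolution M) (i : nat) : nat :=
  match i with
  | 0 => rk F 0 - \rank (bdK F 0)
  | j.+1 => \rank (kermx (bdK F j)) - \rank (bdK F j.+1)
  end.

(* dim_K Tor_i^E(M, K), computed with any resolution: dim_tor F i does not depend
   on F.  (Modules with no resolution by free modules of finite rank get 0.) *)
Definition betti (M : lmodType E) (i : nat) : nat :=
  xget 0%N [set b | exists F : free_resolution M, dim_tor F i = b]%classic.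

(* An infimum of integers, taken in the extended reals: it is -oo when
   betti M i = 0 for all i >= 1, and +oo when no c qualifies. *)
Definition cx (R : realType) (M : lmodType E) : \bar R :=
  ereal_inf [set (c%:~R)%:E | c in [set c : int | exists alpha : R,
    forall i : nat, (1 <= i)%N ->
      (betti M i)%:R <= alpha * (i%:R : R) ^ (c - 1)]]%classic.

(** * Regular sequences and depth *)

Definition linear_form (v : E) : Prop :=
  v \in <<[seq evar K i | i <- enum 'I_n]>>%VS.

(* the submodule J M of M *)
Definition ideal_smul (J : {vspace E}) (M : lmodType E) : set M :=
  [set m | exists (k : nat) (a : 'I_k -> E) (p : 'I_k -> M),
    (forall i, a i \in J) /\ m = \sum_(i < k) a i *: p i]%classic.

(* v is M/N-regular: 0 :_(M/N) (v) = v (M/N) *)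
Definition regular_mod (M : lmodType E) (N : set M) (v : E) : Prop :=
  forall m : M, N (v *: m) <-> exists p : M, N (m - v *: p).

Definition regular_seq (M : lmodType E) (vs : seq E) : Prop :=
  [/\ forall v, v \in vs -> linear_form v,
      forall i, (i < size vs)%N ->
        regular_mod (ideal_smul (ideal_gen (take i vs)) (M := M)) vs`_i
    & exists m : M, ~ ideal_smul (ideal_gen vs) m].

Definition maximal_regular_seq (M : lmodType E) (vs : seq E) : Prop :=
  regular_seq M vs /\ forall v, ~ regular_seq M (rcons vs v).

(* the common length of the maximal M-regular sequences *)
Definition depth (M : lmodType E) : nat :=
  xget 0%N [set d | exists2 vs, maximal_regular_seq M vs & size vs = d]%classic.

End Complexity.

(* Main.v *)
(** Write [I_j = (u_1, ..., u_j)] and [S_j = set(u_j)], so that [I_j / I_(j-1)] is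
    [E / (S_j)] generated in degree [deg u_j].

    Complexity: the mapping cones of lifts of [u_j] from the Cartan resolution of
    [E / (S_j)] to the resolution of [E / I_(j-1)] give a graded resolution of
    [E / I].  It is minimal for degree reasons: the generators of the former in
    homological degree [i] lie in degree [i + deg u_j], those of the latter in
    degrees at most [i - 1 + deg u_j].  Hence [beta_(i+1)(E/I)] is the sum over [j]
    of [binomial (i + |S_j| - 1) i], of growth [i ^ (max |S_j| - 1)].

    Depth: as [dim {x | v x \in J} + dim (J + vE) = dim E + dim J], a sequence of
    [s] linear forms is regular on [E/J] if and only if the codimension of [J] drops
    by the factor [2 ^ s], which depends only on the span [W] of the sequence.  It is
    regular on [E/I] if and only if it is free and [W] meets each span of the
    variables in [S_j] in [0]: "if" follows along the filtration [I_j], and "only if"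
    because a nonzero linear form in the span of the variables in some [S_j] is not
    regular.  Over an infinite field [W] can be enlarged as long as
    [dim W + |S_j| < n] for all [j]. *)
From HB Require Import structures.
Require Import Defs.
From mathcomp Require Import all_boot all_order all_algebra all_field zify.
From mathcomp Require Import boolp.
Import Order.TTheory GRing.Theory Num.Theory.
Local Open Scope ring_scope.
Set Implicit Arguments.
Unset Strict Implicit.
Unset Printing Implicit Defensive.

(** * Monomial ideals of the exterior algebra *)

Section ExteriorBasis.
Variables (K : fieldType) (n : nat).
Local Notation E := (exterior K n).
Implicit Types (A B U S T : {set 'I_n}) (x y z v w : E) (s : seq {set 'I_n}).

Lemma ecoef0 A : ecoef (0 : E) A = 0.
Proof. by rewrite /ecoef ffunE. Qed.

Lemma ecoefN x A : ecoef (- x) A = - ecoef x A.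
Proof. by rewrite -scaleN1r ecoefZ mulN1r. Qed.

Lemma ecoefB x y A : ecoef (x - y) A = ecoef x A - ecoef y A.
Proof. by rewrite ecoefD ecoefN. Qed.

Lemma ecoef_sum (J : Type) (r : seq J) (P : pred J) (F : J -> E) A :
  ecoef (\sum_(j <- r | P j) F j) A = \sum_(j <- r | P j) ecoef (F j) A.
Proof.
by elim/big_rec2: _ => [|j y x _ <-]; rewrite ?ecoef0 ?ecoefD.
Qed.

Lemma ecoef1 A : ecoef (1 : E) A = (A == set0)%:R.
Proof. exact: ecoef_ebasis. Qed.

Lemma ebasis_sum x : x = \sum_A ecoef x A *: ebasis K A.
Proof.
apply: ecoefP => B; rewrite ecoef_sum (bigD1 B) //= big1 => [|A nAB].
  by rewrite ecoefZ ecoef_ebasis eqxx mulr1 addr0.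
by rewrite ecoefZ ecoef_ebasis eq_sym (negPf nAB) mulr0.
Qed.

Lemma ecoef_mul_ebasis x U A : ecoef (x * ebasis K U) A =
  if U \subset A then (-1) ^+ inversions (A :\: U) U * ecoef x (A :\: U)
  else 0.
Proof.
rewrite ecoefM; case: ifP => sUA; last first.
  rewrite big1 // => B sBA; rewrite ecoef_ebasis; case: eqP => [eU|]; last first.
    by rewrite mulr0.
  by rewrite -eU subsetDl in sUA.
have eD (B : {set 'I_n}) : B \subset A -> (A :\: B == U) = (B == A :\: U).
  move=> sBA; apply/eqP/eqP => [<-|->];
  by rewrite setDDr setDv set0U (setIidPr _).
rewrite (bigD1 (A :\: U)) ?subsetDl //= big1 => [|B /andP[sBA nB]].
  by rewrite addr0 ecoef_ebasis eD ?subsetDl // eqxx mulr1 setDDr setDv set0U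
    (setIidPr sUA).
by rewrite ecoef_ebasis eD // (negPf nB) mulr0.
Qed.

Lemma mem_ebasis_span (P : {set {set 'I_n}}) x :
  reflect (forall A, ecoef x A != 0 -> A \in P)
          (x \in <<[seq ebasis K A | A <- enum P]>>%VS).
Proof.
apply: (iffP idP) => [xP A | sxP].
  apply: contraNT => nPA; apply/eqP.
  rewrite (coord_span (X := in_tuple [seq ebasis K A | A <- enum P]) xP).
  rewrite ecoef_sum big1 // => i _; rewrite ecoefZ.
  have: (in_tuple [seq ebasis K A | A <- enum P])`_i
         \in [seq ebasis K A | A <- enum P] by exact: mem_nth.
  case/mapP => B; rewrite mem_enum => PB /= ->.
  rewrite ecoef_ebasis; case: eqP => [eAB|]; last by rewrite mulr0.
  by rewrite eAB PB in nPA.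
rewrite [x]ebasis_sum; apply: memv_suml => A _.
have [-> | /sxP PA] := eqVneq (ecoef x A) 0; first by rewrite scale0r mem0v.
by rewrite memvZ ?memv_span ?map_f ?mem_enum.
Qed.

Lemma mem_ideal_gen (s : seq E) x : x \in s -> x \in ideal_gen s.
Proof.
move=> xs; rewrite -[x]mulr1 -[x]mul1r.
by rewrite !memv_mul ?memvf ?memv_span.
Qed.

Lemma ideal_gen_mull (s : seq E) a x : x \in ideal_gen s -> a * x \in ideal_gen s.
Proof.
move=> xs; have: a * x \in (fullv * ideal_gen s)%VS by rewrite memv_mul ?memvf.
by rewrite /ideal_gen !prodvA; apply/subvP/prodvSl/prodvSl; rewrite subvf.
Qed.

Lemma ideal_gen_mulr (s : seq E) a x : x \in ideal_gen s -> x * a \in ideal_gen s.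
Proof.
move=> xs; have: x * a \in (ideal_gen s * fullv)%VS by rewrite memv_mul ?memvf.
by rewrite /ideal_gen -!prodvA; apply/subvP/prodvSr/prodvSr; rewrite subvf.
Qed.

Lemma ideal_gen_sub (s : seq E) (J : {vspace E}) :
    (forall a x, x \in J -> a * x \in J) ->
    (forall a x, x \in J -> x * a \in J) ->
    {subset s <= J} -> (ideal_gen s <= J)%VS.
Proof.
move=> Jl Jr sJ; apply/prodvP => a b /[swap] _ aP; apply: Jr.
have: (fullv * <<s>> <= J)%VS.
  apply/prodvP => c d _ ds; apply: Jl; move: d ds; apply/subvP.
  exact/span_subvP.
by move/subvP; exact.
Qed.

(** The e_A with A containing some B in [s] span an ideal because these A form an up-set. It is the
    ideal generated by [s], since e_A is e_(A - B) e_B up to sign. *)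
Lemma mem_mono_ideal s x :
  reflect (forall A, ecoef x A != 0 -> has (fun B : {set _} => B \subset A) s)
          (x \in mono_ideal K s).
Proof.
pose P := [set A : {set 'I_n} | has (fun B : {set _} => B \subset A) s].
suff -> : mono_ideal K s = <<[seq ebasis K A | A <- enum P]>>%VS.
  by apply: (iffP (mem_ebasis_span P x)) => h A /h; rewrite inE.
have upP A B : A \in P -> A \subset B -> B \in P.
  rewrite !inE => /hasP[C Cs sCA] sAB; apply/hasP; exists C => //.
  exact: subset_trans sAB.
apply/eqP; rewrite eqEsubv; apply/andP; split.
  apply: ideal_gen_sub => [a y /mem_ebasis_span yP | a y /mem_ebasis_span yP |].
  - apply/mem_ebasis_span => A; apply: contraR => nPA; rewrite ecoefM big1 //.
    move=> B sBA; have [->|/yP] := eqVneq (ecoef y (A :\: B)) 0.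
      by rewrite mulr0.
    by move/upP => /(_ A (subsetDl _ _)); rewrite (negPf nPA).
  - apply/mem_ebasis_span => A; apply: contraR => nPA; rewrite ecoefM big1 //.
    move=> B sBA; have [->|/yP] := eqVneq (ecoef y B) 0.
      by rewrite mulr0 mul0r.
    by move/upP => /(_ A sBA); rewrite (negPf nPA).
  - move=> y /mapP[B Bs ->]; rewrite emonoE; apply/mem_ebasis_span => A.
    rewrite ecoef_ebasis; have [-> _|_] := eqVneq A B; last by rewrite eqxx.
    by rewrite inE; apply/hasP; exists B.
apply/span_subvP => y /mapP[A]; rewrite mem_enum inE => /hasP[B Bs sBA] ->.
have -> : ebasis K A = (-1) ^+ inversions (A :\: B) B *:
                         (ebasis K (A :\: B) * ebasis K B).
  rewrite ebasisM; case: ifPn => [_|/negP[]]; last first.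
    by apply/pred0P => i; rewrite !inE; case: (i \in B); rewrite ?andbF.
  rewrite scalerA -exprMn mulrNN mul1r expr1n scale1r; congr ebasis.
  by rewrite setUC -{1}(setIidPr sBA) setID.
rewrite memvZ ?ideal_gen_mull ?mem_ideal_gen //.
by apply/mapP; exists B; rewrite ?emonoE.
Qed.

(* Over K<e_1, ..., e_n> the left ideal generated by a monomial is two-sided. *)
Lemma mono_ideal_rcons s U x :
  x \in mono_ideal K (rcons s U) <->
  exists a, x - a * emono K U \in mono_ideal K s.
Proof.
split=> [/mem_mono_ideal xs | [a /mem_mono_ideal as_]]; last first.
  apply/mem_mono_ideal => A xA; rewrite has_rcons.
  case: (boolP (U \subset A)) => //= nUA; apply: as_.
  by rewrite ecoefB emonoE ecoef_mul_ebasis (negPf nUA) subr0.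
(* The quotient of x by e_U: up to sign, the coefficient at B is that of x at [B :|: U], set to 0
   when that term already lies in the ideal of [s]. *)
pose f (B : {set 'I_n}) := if has (fun C : {set _} => C \subset B :|: U) s then 0
            else (-1) ^+ inversions B U * ecoef x (B :|: U).
exists (([ffun B => f B] : {ffun {set 'I_n} -> K^o}) : E).
apply/mem_mono_ideal => A; apply: contraR => nA.
rewrite ecoefB emonoE ecoef_mul_ebasis.
have [sUA|nUA] := boolP (U \subset A); last first.
  rewrite subr0; have [//|/xs] := eqVneq (ecoef x A) 0.
  by rewrite has_rcons (negPf nA) (negPf nUA).
have eA : (A :\: U) :|: U = A by rewrite setUC -{1}(setIidPr sUA) setID.
rewrite /ecoef ffunE /f eA (negPf nA) mulrA -exprMn mulrNN mul1r expr1n mul1r.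
by rewrite subrr.
Qed.

Definition evar_ideal S : {vspace E} := ideal_gen [seq evar K k | k <- enum S].

Lemma evar_idealE S : evar_ideal S = mono_ideal K [seq [set k] | k <- enum S].
Proof.
rewrite /evar_ideal /mono_ideal -map_comp; congr ideal_gen.
by apply: eq_map => k /=; rewrite emonoE.
Qed.

Lemma mem_evar_ideal S x :
  reflect (forall A, ecoef x A != 0 -> ~~ [disjoint A & S])
          (x \in evar_ideal S).
Proof.
have e A : has (fun B : {set 'I_n} => B \subset A) [seq [set k] | k <- enum S]
            = ~~ [disjoint A & S].
  apply/hasP/pred0Pn => [[B /mapP[k kS ->]]|[k /andP[kA kS]]].
    by rewrite sub1set => kA; exists k; rewrite /= kA -mem_enum.
  by exists [set k]; rewrite ?sub1set // map_f ?mem_enum.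
by rewrite evar_idealE; apply: (iffP (mem_mono_ideal _ x)) => h A /h; rewrite e.
Qed.

End ExteriorBasis.

(** * Linear forms and regular sequences *)

Section LinearForms.
Variables (K : fieldType) (n : nat).
Local Notation E := (exterior K n).
Implicit Types (A B U S T : {set 'I_n}) (x y z v w : E) (vs : seq E).
Implicit Types (J : {vspace E}).

Definition lin S : {vspace E} := <<[seq evar K k | k <- enum S]>>%VS.

Lemma mem_lin S v :
  reflect (exists2 c : 'I_n -> K, (forall k, k \notin S -> c k = 0) &
             v = \sum_k c k *: evar K k)
          (v \in lin S).
Proof.
have eS : [seq evar K k | k <- enum S]
    = [seq ebasis K A | A <- [seq [set k] | k <- enum S]].
  by rewrite -map_comp.
apply: (iffP idP) => [vS | [c cS ->]]; last first.
  apply: memv_suml => k _; have [kS|/cS ->] := boolP (k \in S).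
    by rewrite memvZ // memv_span // map_f // mem_enum.
  by rewrite scale0r mem0v.
have eP : [seq [set k] | k <- enum S] =i enum [set [set k] | k in S].
  move=> A; rewrite mem_enum; apply/mapP/imsetP => -[k kS ->]; exists k => //.
    by rewrite -mem_enum.
  by rewrite mem_enum.
have eV : lin S = <<[seq ebasis K A | A <- enum [set [set k] | k in S]]>>%VS.
  rewrite /lin eS; apply: eq_span => y.
  by apply/mapP/mapP => -[A AS ->]; exists A; rewrite ?eP // -eP.
move: vS; rewrite eV => /mem_ebasis_span vS.
exists (fun k => ecoef v [set k]) => [k|].
  apply: contraNeq => /vS /imsetP[l lS /set1_inj ->]; exact: lS.
apply: ecoefP => A; rewrite ecoef_sum.
have [/cards1P[l ->]|nA] := boolP (#|A| == 1%N).
  rewrite (bigD1 l) //= big1 => [|k nk].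
    by rewrite ecoefZ ecoef_ebasis eqxx mulr1 addr0.
  by rewrite ecoefZ ecoef_ebasis (inj_eq set1_inj) eq_sym (negPf nk) mulr0.
rewrite big1 => [|k _].
  apply: contraNeq nA => /vS /imsetP[l _ ->]; by rewrite cards1.
rewrite ecoefZ ecoef_ebasis; case: eqP => [eA|]; last by rewrite mulr0.
by rewrite eA cards1 in nA.
Qed.

Lemma linS S T : S \subset T -> (lin S <= lin T)%VS.
Proof.
move=> sST; apply/subvP => v /mem_lin[c cS ->]; apply/mem_lin; exists c => //.
by move=> k nk; apply: cS; apply: contraNN nk; exact: (subsetP sST).
Qed.

Lemma linear_formE v : linear_form v <-> v \in lin setT.
Proof.
rewrite /linear_form /lin; suff -> : enum [set: 'I_n] = enum 'I_n by [].
by apply: eq_enum => i; rewrite !inE.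
Qed.

(** The grading involution, (-1)^d in degree d. Moving a linear form past x replaces x by
    [parity x], see [linear_mul]. *)
Definition parity x : E :=
  ([ffun A : {set 'I_n} => (-1) ^+ #|A| * ecoef x A] : {ffun {set 'I_n} -> K^o}).

Lemma ecoef_parity x A : ecoef (parity x) A = (-1) ^+ #|A| * ecoef x A.
Proof. by rewrite /ecoef ffunE. Qed.

Lemma parityK : involutive parity.
Proof.
move=> x; apply: ecoefP => A.
by rewrite !ecoef_parity mulrA -exprMn mulrNN mul1r expr1n mul1r.
Qed.

Lemma parityD x y : parity (x + y) = parity x + parity y.
Proof. by apply: ecoefP => A; rewrite ecoefD !ecoef_parity ecoefD mulrDr. Qed.

Lemma parityZ (a : K) x : parity (a *: x) = a *: parity x.
Proof. by apply: ecoefP => A; rewrite ecoefZ !ecoef_parity ecoefZ mulrCA. Qed.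

Lemma parity0 : parity 0 = 0.
Proof. by apply: ecoefP => A; rewrite ecoef_parity !ecoef0 mulr0. Qed.

Lemma parity_ebasis A : parity (ebasis K A) = (-1) ^+ #|A| *: ebasis K A.
Proof.
apply: ecoefP => B; rewrite ecoef_parity ecoefZ ecoef_ebasis.
by case: eqP => [->|] //; rewrite !mulr0.
Qed.

Lemma evar_mul_ebasis k A :
  evar K k * ebasis K A = parity (ebasis K A) * evar K k.
Proof.
rewrite parity_ebasis -escalerAl -emonoE /emono cardE.
elim: (enum A) => [|i s IHs].
  by rewrite big_nil mulr1 mul1r expr0 scale1r.
rewrite big_cons mulrA evar_anticomm mulNr -[X in - X]mulrA.
rewrite IHs /= exprS mulN1r.
by rewrite scaleNr -escalerAr !mulrA.
Qed.

Lemma linear_mul v x : v \in lin setT -> v * x = parity x * v.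
Proof.
case/mem_lin => c _ ->; rewrite mulr_suml mulr_sumr; apply: eq_bigr => k _.
rewrite -escalerAl -escalerAr; congr (_ *: _).
rewrite {1 2}[x]ebasis_sum mulr_sumr.
elim/big_rec2: _ => [|A y z _ IH]; first by rewrite parity0 mul0r.
by rewrite parityD mulrDl IH parityZ -escalerAl -escalerAr evar_mul_ebasis.
Qed.

Lemma parity_linear v : v \in lin setT -> parity v = - v.
Proof.
case/mem_lin => c _ ->.
elim/big_rec: _ => [|k y _ IH]; first by rewrite parity0 oppr0.
by rewrite parityD opprD IH parityZ parity_ebasis cards1 expr1 scaleN1r scalerN.
Qed.

(** Anticommutation alone gives 2 v^2 = 0. To cover characteristic 2, one variable is split off at a
    time: its square vanishes and the cross terms cancel. *)
Lemma linear_sqr v : v \in lin setT -> v * v = 0.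
Proof.
case/mem_lin => c _ ->.
suff: forall r : seq 'I_n,
    (\sum_(k <- r) c k *: evar K k) * (\sum_(k <- r) c k *: evar K k) = 0.
  by apply.
elim=> [|k r IHr]; first by rewrite big_nil mul0r.
rewrite big_cons; set a := \sum_(_ <- r) _ in IHr *.
have aV : a \in lin setT.
  apply: memv_suml => l _; apply: memvZ; apply: memv_span.
  by rewrite map_f // mem_enum inE.
have kV : evar K k \in lin setT.
  by apply: memv_span; rewrite map_f // mem_enum inE.
rewrite mulrDl !mulrDr IHr addr0 -!escalerAl -!escalerAr evar_sqr !scaler0 add0r.
by rewrite (linear_mul a kV) (parity_linear aV) mulNr scalerN addNr.
Qed.

Definition principal v : {vspace E} := (amull v @: fullv)%VS.

Lemma mem_principal v x : reflect (exists p, x = v * p) (x \in principal v).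
Proof.
apply: (iffP memv_imgP) => [[p _ ->]|[p ->]]; exists p; rewrite ?memvf //;
by rewrite lfunE.
Qed.

Lemma mem_add_principal J v x :
  reflect (exists p, x - v * p \in J) (x \in (J + principal v)%VS).
Proof.
apply: (iffP memv_addP) => [[j jJ [_ /mem_principal[p ->] ->]]|[p pJ]].
  by exists p; rewrite addrK.
by exists (x - v * p) => //; exists (v * p); rewrite ?subrK //; apply/mem_principal; exists p.
Qed.

Definition is_ideal J :=
  (forall a x, x \in J -> a * x \in J) /\ (forall a x, x \in J -> x * a \in J).

Lemma ideal_gen_ideal vs : is_ideal (ideal_gen vs).
Proof. by split=> a x; [exact: ideal_gen_mull | exact: ideal_gen_mulr]. Qed.

Lemma ideal_add J J' : is_ideal J -> is_ideal J' -> is_ideal (J + J')%VS.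
Proof.
move=> [Jl Jr] [Jl' Jr']; split=> a x /memv_addP[y yJ [z zJ ->]].
  by rewrite mulrDr memv_add // ?Jl ?Jl'.
by rewrite mulrDl memv_add // ?Jr ?Jr'.
Qed.

Lemma principal_ideal v : v \in lin setT -> is_ideal (principal v).
Proof.
move=> vV; split=> a x /mem_principal[p ->]; apply/mem_principal.
  exists (parity a * p); rewrite !mulrA (linear_mul _ vV) parityK //.
by exists (p * a); rewrite mulrA.
Qed.

Lemma ideal_add_principal J v :
  is_ideal J -> v \in lin setT -> is_ideal (J + principal v)%VS.
Proof. by move=> ? ?; apply: ideal_add => //; exact: principal_ideal. Qed.

Lemma ideal_gen_nil : ideal_gen (nil : seq E) = 0%VS.
Proof. by rewrite /ideal_gen span_nil prodv0 prod0v. Qed.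

Lemma ideal_gen_cat vs ws :
  ideal_gen (vs ++ ws) = (ideal_gen vs + ideal_gen ws)%VS.
Proof. by rewrite /ideal_gen span_cat prodvDr prodvDl. Qed.

Lemma ideal_gen1 v : v \in lin setT -> ideal_gen [:: v] = principal v.
Proof.
move=> vV; have [Jl Jr] := principal_ideal vV.
apply/eqP; rewrite eqEsubv; apply/andP; split.
  apply: ideal_gen_sub => // x; rewrite inE => /eqP ->.
  by apply/mem_principal; exists 1; rewrite mulr1.
apply/subvP => x /mem_principal[p ->]; apply: ideal_gen_mulr.
by apply: mem_ideal_gen; rewrite inE.
Qed.

Lemma ideal_gen_cons v vs : v \in lin setT ->
  ideal_gen (v :: vs) = (principal v + ideal_gen vs)%VS.
Proof. by move=> vV; rewrite -cat1s ideal_gen_cat ideal_gen1. Qed.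

(* v is regular on E/J *)
Definition regular J v : bool := (amull v @^-1: J == J + principal v)%VS.

Fixpoint regular_list J vs : bool :=
  if vs is v :: vs' then regular J v && regular_list (J + principal v)%VS vs'
  else true.

(** The inclusion of J + vE in {x | v x in J} is automatic, as v^2 = 0; regularity amounts to the
    other inclusion. *)
Lemma regularP J v : is_ideal J -> v \in lin setT ->
  reflect (forall x, v * x \in J -> exists p, x - v * p \in J) (regular J v).
Proof.
move=> [Jl Jr] vV; apply: (iffP eqP) => [e x xJ | h].
  by apply/mem_add_principal; rewrite -e -memv_preim lfunE.
apply/vspaceP => x; rewrite -memv_preim lfunE /=.
apply/idP/mem_add_principal => [/h //|[p pJ]].
rewrite -[x](subrK (v * p)) mulrDr memvD ?(Jl v _ pJ) //.
by rewrite mulrA linear_sqr // mul0r mem0v.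
Qed.

Definition codim J : nat := (\dim {:E} - \dim J)%N.

(** Let P = {x | v x in J}. Rank-nullity for x -> v x, on E and on P, gives dim P + dim (J + vE) =
    dim E + dim J. As P contains J + vE, the inequality follows, with equality exactly when P = J +
    vE. *)
Lemma codim_regular J v : is_ideal J -> v \in lin setT ->
  (codim J <= 2 * codim (J + principal v)%VS ?= iff regular J v)%N.
Proof.
move=> JI vV; have [Jl Jr] := JI.
have sJ : (J + principal v <= amull v @^-1: J)%VS.
  apply/subvP => x /mem_add_principal[p pJ]; rewrite -memv_preim lfunE /=.
  rewrite -[x](subrK (v * p)) mulrDr memvD ?(Jl v _ pJ) //.
  by rewrite mulrA linear_sqr // mul0r mem0v.
have eD : (\dim (amull v @^-1: J) + \dim (J + principal v)
          = \dim {:E} + \dim J)%N.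
  have e1 : (\dim (J + principal v) + \dim (J :&: principal v)
            = \dim J + \dim (principal v))%N := dimv_sum_cap _ _.
  have e2 : (\dim (lker (amull v)) + \dim (principal v) = \dim {:E})%N.
    by rewrite -(limg_ker_dim (amull v) {:E}) capfv.
  have e3 : (\dim (lker (amull v)) + \dim (J :&: principal v)
            = \dim (amull v @^-1: J))%N.
    rewrite -(limg_ker_dim (amull v) (amull v @^-1: J)).
    have -> : (amull v @^-1: J :&: lker (amull v) = lker (amull v))%VS.
      apply/capv_idPr/subvP => x; rewrite memv_ker -memv_preim => /eqP ->.
      exact: mem0v.
    by rewrite -(lpreim_cap_limg (amull v) J) lpreimK ?capvSr.
  by move: e1 e2 e3; lia.
have := dimvS (subvf (amull v @^-1: J)); have := dimvS sJ.
have := dimvS (subvf J).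
rewrite /codim /regular eq_sym eqEdim sJ /= => h1 h2 h3.
have arith (N j p q : nat) : (p + q = N + j -> j <= N -> q <= p -> p <= N ->
    (N - j <= 2 * (N - q) ?= iff (p <= q)))%N.
  by move=> *; split; [lia | apply/eqP/idP; lia].
exact: arith.
Qed.

(** Each linear form divides the codimension by at most 2, and the chained inequalities give an
    equality only if each of them is one. The bound sees [vs] only through its length and the ideal
    it generates. *)
Lemma codim_regular_list J vs : is_ideal J -> {subset vs <= lin setT} ->
  (codim J <= 2 ^ size vs * codim (J + ideal_gen vs)%VS
     ?= iff regular_list J vs)%N.
Proof.
elim: vs J => [|v vs IHvs] J JI sV.
  by rewrite ideal_gen_nil addv0 expn0 mul1n; split; rewrite ?leqnn ?eqxx.
have vV : v \in lin setT by apply: sV; rewrite inE eqxx.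
have sV' : {subset vs <= lin setT} by move=> y ys; apply: sV; rewrite inE ys orbT.
have := IHvs _ (ideal_add_principal JI vV) sV'.
rewrite -addvA -ideal_gen_cons //= expnS -mulnA.
have [le1 <-] := codim_regular JI vV; set c := (2 ^ _ * _)%N => -[le2 <-].
by split; [lia | apply/eqP/andP => [?|[]]; first split; lia].
Qed.

Lemma regular_list_cat J vs ws : {subset vs <= lin setT} ->
  regular_list J (vs ++ ws) =
  regular_list J vs && regular_list (J + ideal_gen vs)%VS ws.
Proof.
elim: vs J => [|v vs IHvs] J sV /=; first by rewrite ideal_gen_nil addv0.
have vV : v \in lin setT by apply: sV; rewrite inE eqxx.
rewrite IHvs => [|y ys]; last by apply: sV; rewrite inE ys orbT.
by rewrite -andbA -addvA -ideal_gen_cons.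
Qed.

(** Lists with the same span generate the same ideal. If [ws] spans the same space and its length is
    the dimension, comparing 2^(size vs) with 2^(size ws), the codimension being nonzero, forces
    equal lengths and regularity of [ws]. *)
Lemma regular_list_span J vs w : is_ideal J -> {subset vs <= lin setT} ->
    (J + ideal_gen vs != fullv)%VS -> regular_list J vs ->
  free vs /\ (w \in <<vs>>%VS -> w != 0 -> regular J w).
Proof.
move=> JI sV nJ rJ.
have c0 : (0 < codim (J + ideal_gen vs))%N.
  by rewrite /codim subn_gt0 (ltn_leqif (dimv_leqif_eq (subvf _))).
have [_] := codim_regular_list JI sV; rewrite rJ => /eqP eJ.
have vsV : (<<vs>> <= lin setT)%VS by exact/span_subvP.
have key (ws : seq E) : <<ws>>%VS = <<vs>>%VS -> size ws = \dim <<vs>> ->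
    size vs = size ws /\ regular_list J ws.
  move=> e sz; have sV' : {subset ws <= lin setT}.
    by move=> y /memv_span; rewrite e; apply/subvP.
  have [le1 <-] := codim_regular_list JI sV'.
  have e' : ideal_gen ws = ideal_gen vs by rewrite /ideal_gen e.
  move: le1; rewrite e' eJ leq_mul2r eqn_mul2r eqn0Ngt c0 /= leq_exp2l //.
  move=> le1; have le2 : (size ws <= size vs)%N by rewrite sz dim_span.
  have -> : size ws = size vs by apply/eqP; rewrite eqn_leq le1 le2.
  by rewrite eqxx.
have [e _] := key (vbasis <<vs>>%VS) (span_basis (vbasisP _)) (size_tuple _).
split=> [|wU w0]; first by rewrite /free e size_tuple.
have wU' : (<[w]> <= <<vs>>)%VS by [].
(* A basis of the span that starts with w: its regularity contains that of w. *)
have [||_] := key (w :: vbasis (<<vs>> :\: <[w]>)%VS).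
- rewrite span_cons (span_basis (vbasisP _)) addvC addv_diff.
  exact/addv_idPl.
- rewrite /= size_tuple; have := dimv_cap_compl <<vs>>%VS <[w]>%VS.
  by rewrite (capv_idPr wU') dim_vline w0; lia.
by case/andP.
Qed.

(** Here A = J : u and J' = J + E u, so right multiplication by u gives an exact sequence 0 -> E/A
    -> E/J -> E/J' -> 0. The proof is the chase from the first two modules to the third. *)
Lemma regular_colon (u : E) J (A : {vspace E}) J' v : is_ideal J -> is_ideal A -> is_ideal J' ->
    (forall x, x * u \in J <-> x \in A) ->
    (forall x, x \in J' <-> exists a, x - a * u \in J) ->
    v \in lin setT -> regular J v -> regular A v -> regular J' v.
Proof.
move=> JI AI JI' cE aE vV /(regularP JI vV) rJ /(regularP AI vV) rA.
apply/(regularP JI' vV) => x /aE[a xa]; have [Jl _] := JI.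
have /cE/rA[b /cE] : v * a * u \in J.
  have := Jl v _ xa; rewrite mulrBr !mulrA linear_sqr // mul0r sub0r.
  by rewrite rpredN.
rewrite mulrBl => ab; have /rJ[p pJ] : v * (x - b * u) \in J.
  by rewrite mulrBr -[v * x](subrK (a * u)) -addrA memvD // mulrA.
by exists p; apply/aE; exists b; rewrite addrAC.
Qed.

(** The sequence 0 -> E/A -> E/J -> E/J' -> 0 stays exact on the left modulo v when v is regular on
    E/J'. This lets [regular_colon] be iterated. *)
Lemma colon_principal (u : E) J (A : {vspace E}) J' v : is_ideal J -> is_ideal J' ->
    (forall x, x * u \in J <-> x \in A) ->
    (forall x, x \in J' <-> exists a, x - a * u \in J) ->
    v \in lin setT -> regular J' v ->
  forall x, x * u \in (J + principal v)%VS <-> x \in (A + principal v)%VS.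
Proof.
move=> JI JI' cE aE vV /(regularP JI' vV) rJ' x; have [Jl _] := JI.
split=> [/mem_add_principal[y xy]|/mem_add_principal[p /cE]]; last first.
  rewrite mulrBl => h; apply/mem_add_principal; exists (p * u).
  by rewrite mulrA.
have /rJ'[z /aE[b yb]] : v * y \in J'.
  by apply/aE; exists x; rewrite -opprB rpredN.
apply/mem_add_principal; exists b; apply/cE; rewrite mulrBl.
have := Jl v _ yb; rewrite !mulrBr mulrA linear_sqr // mul0r subr0 => h.
by rewrite -[x * u](subrK (v * y)) -addrA memvD // -mulrA.
Qed.

Lemma regular_list_colon (u : E) vs J (A : {vspace E}) J' :
    is_ideal J -> is_ideal A -> is_ideal J' ->
    (forall x, x * u \in J <-> x \in A) ->
    (forall x, x \in J' <-> exists a, x - a * u \in J) ->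
    {subset vs <= lin setT} ->
  regular_list J vs -> regular_list A vs -> regular_list J' vs.
Proof.
elim: vs J A J' => //= v vs IHvs J A J' JI AI JI' cE aE sV.
have vV : v \in lin setT by apply: sV; rewrite inE eqxx.
move=> /andP[rJ rJs] /andP[rA rAs].
have rJ' := regular_colon JI AI JI' cE aE vV rJ rA; rewrite rJ' /=.
apply: (IHvs (J + principal v)%VS (A + principal v)%VS) => //.
- exact: ideal_add_principal.
- exact: ideal_add_principal.
- exact: ideal_add_principal.
- exact: colon_principal aE vV rJ'.
- move=> x; split=> [/mem_add_principal[p /aE[a h]]|[a /mem_add_principal[p h]]].
    by exists a; apply/mem_add_principal; exists p; rewrite addrAC.
  by apply/mem_add_principal; exists p; apply/aE; exists a; rewrite addrAC.
- by move=> y ys; apply: sV; rewrite inE ys orbT.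
Qed.

Lemma ecoef_lin S v A : v \in lin S -> ecoef v A != 0 ->
  exists2 k, k \in S & A = [set k].
Proof.
case/mem_lin => c cS ->; rewrite ecoef_sum => nz.
have [k] : exists k, ecoef (c k *: evar K k) A != 0.
  apply/existsP; apply: contraNT nz; rewrite negb_exists => /forallP h.
  by rewrite big1 // => k _; apply/eqP; have := h k; rewrite negbK.
rewrite ecoefZ ecoef_ebasis; have [-> nz'|_] := eqVneq A [set k]; last first.
  by rewrite mulr0 eqxx.
by exists k => //; apply: contraNT nz' => /cS ->; rewrite mul0r.
Qed.

Lemma dim_exterior : \dim {:E} = (2 ^ n)%N.
Proof.
rewrite dimvf; transitivity (#|{set 'I_n}| * 1)%N => //.
by rewrite muln1 -cardsT -powersetT card_powerset cardsT card_ord.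
Qed.

Lemma codim0 : codim 0 = (2 ^ n)%N.
Proof. by rewrite /codim dimv0 subn0 dim_exterior. Qed.

Lemma codim_maximal : codim (evar_ideal K [set: 'I_n]) = 1%N.
Proof.
have mE x : (x \in evar_ideal K [set: 'I_n]) = (ecoef x set0 == 0).
  apply/mem_evar_ideal/eqP => [h|h A].
    apply/eqP; apply: contraT => /h; rewrite disjoints_subset sub0set //.
  apply: contraNN => /pred0P d; suff -> : A = set0 by rewrite h.
  by apply/setP => i; have := d i; rewrite !inE andbT.
have e : (evar_ideal K [set: 'I_n] + <[1]> = fullv)%VS.
  apply/eqP; rewrite eqEsubv subvf /=; apply/subvP => x _.
  apply/memv_addP; exists (x - ecoef x set0 *: 1).
    by rewrite mE ecoefB ecoefZ ecoef1 eqxx mulr1 subrr.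
  by exists (ecoef x set0 *: 1); rewrite ?subrK // memvZ // memv_line.
have := dimv_sum_cap (evar_ideal K [set: 'I_n]) <[1]>%VS.
have -> : (evar_ideal K [set: 'I_n] :&: <[1]> = 0)%VS.
  apply/eqP; rewrite -subv0; apply/subvP => x /memv_capP[+ /vlineP[a ea]].
  by rewrite mE ea ecoefZ ecoef1 eqxx mulr1 memv0 => /eqP ->; rewrite scale0r.
by rewrite e dimv0 dim_vline oner_neq0 /codim; lia.
Qed.

Lemma zero_ideal : is_ideal 0.
Proof.
by split=> a x; rewrite !memv0 => /eqP ->; rewrite ?mulr0 ?mul0r.
Qed.

Lemma span_lin vs : <<vs>>%VS = lin setT -> {subset vs <= lin setT}.
Proof. by move=> <- y /memv_span. Qed.

(** For J = 0, [codim_regular_list] compares 2^n with 2^(size vs), because [vs] generates (e_1, ...,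
    e_n), of codimension 1. *)
Lemma codim_basis vs : <<vs>>%VS = lin setT ->
  (n <= size vs)%N /\ (size vs = n -> regular_list 0 vs).
Proof.
move=> e; have := codim_regular_list zero_ideal (span_lin e).
have -> : ideal_gen vs = evar_ideal K [set: 'I_n].
  by rewrite /ideal_gen e.
rewrite add0v codim0 codim_maximal muln1 => -[le1 <-].
by split=> [|->]; rewrite ?eqxx // -(@leq_exp2l 2).
Qed.

(** The dimension is at most the number of variables. For S and its complement these bounds add up
    to n, while the two spans together have dimension at least n by [codim_basis]. *)
Lemma dim_lin S : \dim (lin S) = #|S|.
Proof.
have le T : (\dim (lin T) <= #|T|)%N.
  by apply: leq_trans (dim_span _) _; rewrite size_map -cardE.
have [le1 _] := codim_basis (span_basis (vbasisP (lin [set: 'I_n]))).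
rewrite size_tuple in le1.
have := le S; have := le (~: S); have := cardsC S; rewrite card_ord.
suff : (\dim (lin [set: 'I_n]) <= \dim (lin S) + \dim (lin (~: S)))%N by lia.
apply: leq_trans (dimv_add_leqif _ _); apply: dimvS.
apply/span_subvP => y /mapP[k _ ->]; have [kS|kS] := boolP (k \in S).
  by rewrite (subvP (addvSl _ _)) // memv_span // map_f // mem_enum.
by rewrite (subvP (addvSr _ _)) // memv_span // map_f // mem_enum inE.
Qed.

(** The variables in S followed by [vs] extend to a basis of the linear forms, which is regular on E
    by [codim_basis]; [vs] is the segment following the variables in S. *)
Lemma regular_list_evar S vs : {subset vs <= lin setT} -> free vs ->
  (lin S :&: <<vs>> = 0)%VS -> regular_list (evar_ideal K S) vs.
Proof.
move=> sV fV cap.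
pose U := (lin S + <<vs>>)%VS.
pose X : seq E := vbasis (lin [set: 'I_n] :\: U)%VS.
pose b := [seq evar K k | k <- enum S] ++ vs ++ X.
have sU : (U <= lin [set: 'I_n])%VS.
  by rewrite subv_add linS ?subsetT //=; exact/span_subvP.
have eb : <<b>>%VS = lin setT.
  rewrite !span_cat (span_basis (vbasisP _)) addvA -/(lin S) -/U.
  by rewrite addvC addv_diff; exact/addv_idPl.
have sb : size b = n.
  rewrite !size_cat size_map -cardE size_tuple.
  have e1 := dimv_cap_compl (lin [set: 'I_n]) U; rewrite (capv_idPr sU) in e1.
  have e2 : \dim U = (#|S| + size vs)%N.
    by rewrite dimv_disjoint_sum // dim_lin (eqP fV).
  by move: e1; rewrite e2 dim_lin cardsT card_ord addnA.
have := (codim_basis eb).2 sb; rewrite regular_list_cat; last first.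
  by move=> y ys; apply: (span_lin eb); rewrite mem_cat ys.
by case/andP => _; rewrite add0v regular_list_cat // => /andP[].
Qed.

End LinearForms.

(** * Regular sequences modulo an ideal with linear quotients *)

Section Chain.
Variables (K : fieldType) (n : nat).
Local Notation E := (exterior K n).
Local Notation V1 := (lin K [set: 'I_n]).
Implicit Types (A B U T : {set 'I_n}) (x y z v w : E) (vs : seq E).
Implicit Types (us pre post : seq {set 'I_n}) (S : {set 'I_n} -> {set 'I_n}).

(** Linear quotients with set(U) replaced by an arbitrary function S. Quantifying over splittings of
    the list lets the property pass to prefixes. *)
Definition colon_chain S us : Prop :=
  forall pre U post, us = pre ++ U :: post ->
    forall x, (x * emono K U \in mono_ideal K pre) = (x \in evar_ideal K (S U)).

Lemma colon_chain_rcons S us U : colon_chain S (rcons us U) -> colon_chain S us.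
Proof.
move=> h pre T post e; apply: (h pre T (rcons post U)).
by rewrite e rcons_cat.
Qed.

Lemma mono_ideal_ideal us : is_ideal (mono_ideal K us).
Proof. exact: ideal_gen_ideal. Qed.

Lemma evar_ideal_ideal T : is_ideal (evar_ideal K T).
Proof. exact: ideal_gen_ideal. Qed.

Lemma mono_ideal_nil : mono_ideal K (nil : seq {set 'I_n}) = 0%VS.
Proof. exact: ideal_gen_nil. Qed.

Lemma evar_ideal0 : evar_ideal K (set0 : {set 'I_n}) = 0%VS.
Proof. by rewrite /evar_ideal enum_set0 ideal_gen_nil. Qed.

Lemma lin0 : lin K (set0 : {set 'I_n}) = 0%VS.
Proof. by rewrite /lin enum_set0 span_nil. Qed.

Lemma one_notin_evar_ideal T : 1 \notin evar_ideal K T.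
Proof.
apply/negP => /mem_evar_ideal /(_ set0); rewrite ecoef1 eqxx oner_neq0.
by move=> /(_ isT); rewrite disjoints_subset sub0set.
Qed.

(** Since 1 is not in the ideal of the variables in [S U], e_U is not in the ideal of [pre]. *)
Lemma emono_notin_prefix S pre U post : colon_chain S (pre ++ U :: post) ->
  ~~ has (fun B : {set 'I_n} => B \subset U) pre.
Proof.
move=> /(_ _ _ _ erefl 1); rewrite mul1r (negPf (one_notin_evar_ideal _)).
move=> e; apply: contraFN e => h; apply/mem_mono_ideal => A.
by rewrite emonoE ecoef_ebasis; have [->|_] := eqVneq A U; rewrite ?h ?eqxx.
Qed.

Lemma lin_sub_evar_ideal T v : v \in lin K T -> v \in evar_ideal K T.
Proof.
move=> vT; apply/mem_evar_ideal => A /(ecoef_lin vT)[k kT ->].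
by rewrite disjoints1 kT.
Qed.

(** Induction along the filtration: adding U is the situation of [regular_list_colon], whose
    submodule E/(S U) is covered by [regular_list_evar]. The empty list is the case of no
    variables. *)
Lemma regular_list_chain S us vs : colon_chain S us ->
    {subset vs <= V1} -> free vs ->
    (forall U, U \in us -> (lin K (S U) :&: <<vs>> = 0)%VS) ->
  regular_list (mono_ideal K us) vs.
Proof.
move=> + sV fV; elim/last_ind: us => [|us U IHus] ch cap.
  rewrite mono_ideal_nil -evar_ideal0; apply: regular_list_evar => //.
  by rewrite lin0 cap0v.
have ch' := colon_chain_rcons ch.
apply: (@regular_list_colon _ _ (emono K U) vs (mono_ideal K us)
  (evar_ideal K (S U))) => //.
- exact: mono_ideal_ideal.
- exact: evar_ideal_ideal.
- exact: mono_ideal_ideal.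
- by move=> x; rewrite (ch us U [::]) ?cats1.
- exact: mono_ideal_rcons.
- by apply: IHus => // T Tus; apply: cap; rewrite mem_rcons inE Tus orbT.
- by apply: regular_list_evar => //; apply: cap; rewrite mem_rcons inE eqxx.
Qed.

Lemma sorted_prefix pre U post B :
  sorted leq [seq #|T| | T : {set 'I_n} <- pre ++ U :: post] ->
  B \in pre ++ U :: post -> (#|B| < #|U|)%N -> B \in pre.
Proof.
rewrite map_cat mem_cat => /cat_sorted2[_ /= /(order_path_min leq_trans) /allP h].
case/orP => // /[!inE] /orP[/eqP ->|Bp]; first by rewrite ltnn.
by rewrite ltnNge h // map_f.
Qed.

(* Take the first U with w in the span of S U: then w is regular modulo the
   preceding monomials, so e_U = w z modulo these, and z is not in (w) modulo the
   ideal because in degree #|U| - 1 only the preceding monomials contribute. *)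
Lemma chain_not_regular S us w :
    colon_chain S us -> sorted leq [seq #|U| | U : {set 'I_n} <- us] ->
    w != 0 -> has (fun U => w \in lin K (S U)) us ->
  ~~ regular (mono_ideal K us) w.
Proof.
move=> ch srt w0 hw; case/split_find: hw ch srt => U pre post wU wpre.
rewrite -cats1 -catA /= => ch srt.
have wV : w \in V1 by apply: (subvP (linS _ (subsetT (S U)))).
have ch' : colon_chain S pre.
  by move=> p T q e; apply: (ch p T (q ++ U :: post)); rewrite e -catA.
have rpre : regular (mono_ideal K pre) w.
  suff: regular_list (mono_ideal K pre) [:: w] by rewrite /= andbT.
  apply: (regular_list_chain ch').
  - by move=> y; rewrite inE => /eqP ->.
  - by rewrite seq1_free.
  - move=> T Tp; apply/eqP; rewrite -subv0 span_seq1.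
    apply/subvP => y /memv_capP[+ /vlineP[a ya]].
    rewrite {}ya memv0; have [->|a0] := eqVneq a 0; first by rewrite scale0r.
    rewrite rpredZeq (negPf a0) /= => wT; case/hasP: wpre; exists T => //.
have [p wp] : exists p, emono K U - w * p \in mono_ideal K pre.
  apply: (regularP _ _ rpre) => //; first exact: mono_ideal_ideal.
  by rewrite (ch _ _ _ erefl) lin_sub_evar_ideal.
apply/negP => /(regularP (mono_ideal_ideal _) wV) /(_ p)[|q pq].
  rewrite -[w * p](subKr (emono K U)) memvB //; apply/mem_mono_ideal => A.
    rewrite has_cat /= emonoE ecoef_ebasis; have [->|] := eqVneq A U.
      by rewrite subxx orbT.
    by rewrite eqxx.
  by move=> /(mem_mono_ideal _ _ wp); rewrite has_cat => ->.
(* Since w^2 = 0, subtracting w q from p does not change w p. *)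
have /mem_mono_ideal/(_ U) : emono K U - w * (p - w * q) \in mono_ideal K pre.
  by rewrite mulrBr mulrA linear_sqr // mul0r subr0.
have npre := emono_notin_prefix ch.
rewrite (negPf npre) ecoefB emonoE ecoef_ebasis eqxx => h.
have : ecoef (w * (p - w * q)) U != 0.
  by apply: contraTneq isT => e0; apply: h; rewrite e0 subr0 oner_neq0.
rewrite ecoefM; apply/negP; rewrite negbK; apply/eqP; apply: big1 => A AU.
have [->|/(ecoef_lin wV)[k _ eA]] := eqVneq (ecoef w A) 0.
  by rewrite mulr0 mul0r.
(* As p - w q lies in the ideal of [us], a nonzero coefficient at [U :\: A] yields a generator B of
   degree less than [#|U|], which sortedness places in [pre]. *)
have [->|nz] := eqVneq (ecoef (p - w * q) (U :\: A)) 0; first by rewrite mulr0.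
have /hasP[B Bus sB] := mem_mono_ideal _ _ pq _ nz.
case/hasP: npre; exists B; last exact: subset_trans sB (subsetDl _ _).
apply: (sorted_prefix srt Bus); apply: leq_ltn_trans (subset_leq_card sB) _.
rewrite cardsD (setIidPr AU) eA cards1 subn1 ltn_predL.
by apply/card_gt0P; exists k; rewrite (subsetP AU) // eA inE.
Qed.

Lemma ecoef0_lin_ideal vs x : {subset vs <= V1} -> x \in ideal_gen vs ->
  ecoef x set0 = 0.
Proof.
move=> sV xs; have : x \in evar_ideal K [set: 'I_n].
  apply: (subvP _ x xs); apply: ideal_gen_sub => [a y|a y|y ys].
  - exact: (evar_ideal_ideal _).1.
  - exact: (evar_ideal_ideal _).2.
  - exact/lin_sub_evar_ideal/sV.
move/mem_evar_ideal/(_ set0)/contraNeq; apply.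
by rewrite negbK disjoints_subset sub0set.
Qed.

Lemma proper_add us vs : set0 \notin us -> {subset vs <= V1} ->
  (mono_ideal K us + ideal_gen vs != fullv)%VS.
Proof.
move=> us0 sV; apply: contraNneq us0 => e.
have : 1 \in (mono_ideal K us + ideal_gen vs)%VS by rewrite e memvf.
case/memv_addP => a aI [b bI e1].
have := congr1 (fun x : E => ecoef x set0) e1.
rewrite ecoef1 eqxx ecoefD (ecoef0_lin_ideal sV bI) addr0 => a1.
have /hasP[B Bus] : has (fun B : {set 'I_n} => B \subset set0) us.
  by apply: (mem_mono_ideal _ _ aI); rewrite -a1 oner_neq0.
by rewrite subset0 => /eqP <-.
Qed.

(** A nonzero w in an intersection would be regular by [regular_list_span], but is not by
    [chain_not_regular]. *)
Lemma regular_list_iff S us vs : colon_chain S us ->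
    sorted leq [seq #|U| | U : {set 'I_n} <- us] -> set0 \notin us ->
    {subset vs <= V1} ->
  regular_list (mono_ideal K us) vs <->
  free vs /\ forall U, U \in us -> (lin K (S U) :&: <<vs>> = 0)%VS.
Proof.
move=> ch srt us0 sV; split=> [r|[fV cap]]; last exact: (regular_list_chain ch).
have nT := proper_add us0 sV.
split=> [|U Uus].
  by have [] := regular_list_span 0 (mono_ideal_ideal us) sV nT r.
apply/eqP; rewrite -subv0; apply/subvP => w /memv_capP[wU wV]; rewrite memv0.
apply: contraT => w0.
have [_ /(_ wV w0)] := regular_list_span w (mono_ideal_ideal us) sV nT r.
apply: contraTT => _; apply: (chain_not_regular ch) => //.
by apply/hasP; exists U.
Qed.

Lemma regular_list_size S us vs : colon_chain S us ->
    sorted leq [seq #|U| | U : {set 'I_n} <- us] -> set0 \notin us ->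
    {subset vs <= V1} -> regular_list (mono_ideal K us) vs ->
  forall U, U \in us -> (#|S U| + size vs <= n)%N.
Proof.
move=> ch srt us0 sV /(regular_list_iff ch srt us0 sV)[fV cap] U Uus.
have : (\dim (lin K (S U) + <<vs>>) <= \dim V1)%N.
  by rewrite dimvS // subv_add linS ?subsetT //=; exact/span_subvP.
by rewrite dimv_disjoint_sum ?cap // !dim_lin (eqP fV) cardsT card_ord.
Qed.

(** A vector space over an infinite field is not a finite union of proper subspaces; infinity is
    stated as: no finite list exhausts K. *)
Lemma avoid_subspaces (Vs : seq {vspace E}) (V : {vspace E}) :
    (forall s : seq K, exists a, a \notin s) ->
    (forall W, W \in Vs -> ~~ (V <= W)%VS) ->
  exists2 v, v \in V & forall W, W \in Vs -> v \notin W.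
Proof.
move=> infK; elim: Vs => [|W Vs IHVs] nV; first by exists 0; rewrite ?mem0v.
have [|v vV nv] := IHVs; first by move=> X XV; apply: nV; rewrite inE XV orbT.
have /subvPn[y yV ny] : ~~ (V <= W)%VS by apply: nV; rewrite inE eqxx.
(* No X in the list contains both v and y, so the line v + K y meets each X in at most one point;
   [s] collects the parameters of these points. *)
have [s hs] : exists s : seq K, forall X, X \in W :: Vs ->
    forall a, v + a *: y \in X -> a \in s.
  have : forall X, X \in W :: Vs -> (v \notin X) || (y \notin X).
    by move=> X /[!inE] /orP[/eqP ->|/nv ->] //; rewrite ny orbT.
  elim: (W :: Vs) => [|X Xs IHX] h; first by exists [::].
  have [|s hs] := IHX; first by move=> Z ZX; apply: h; rewrite inE ZX orbT.
  have nX := h X (mem_head _ _).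
  have [[a0 h0]|no] := pselect (exists a, v + a *: y \in X); last first.
    exists s => Z /[!inE] /orP[/eqP -> a va|/hs //].
    by case: no; exists a.
  exists (a0 :: s) => Z /[!inE] /orP[/eqP ->|/hs hZ] a; last first.
    by move=> /hZ; rewrite inE orbC => ->.
  move=> va; rewrite inE; apply/orP; left; rewrite -subr_eq0; apply: contraT => d0.
  have yX : y \in X.
    suff : (a - a0) *: y \in X by rewrite rpredZeq (negPf d0).
    rewrite scalerBl.
    have -> : a *: y - a0 *: y = (v + a *: y) - (v + a0 *: y).
      by rewrite opprD addrACA subrr add0r.
    by rewrite memvB.
  have vX : v \in X by rewrite -[v](addrK (a *: y)) memvB // memvZ.
  by rewrite vX yX in nX.
have [a na] := infK s; exists (v + a *: y); first by rewrite memvD // memvZ.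
by move=> X XW; apply: contraNN na; apply: hs.
Qed.

(** The spaces [<<vs>>] and [lin K (S U) + <<vs>>] have dimension less than n, so some linear form v
    avoids them all. Then [rcons vs v] is free and its span still meets each [lin K (S U)] in 0. *)
Lemma regular_list_extend S us vs : colon_chain S us ->
    sorted leq [seq #|U| | U : {set 'I_n} <- us] -> set0 \notin us ->
    (forall s : seq K, exists a, a \notin s) ->
    {subset vs <= V1} -> regular_list (mono_ideal K us) vs ->
    (size vs < n)%N -> (forall U, U \in us -> (#|S U| + size vs < n)%N) ->
  exists2 v, v \in V1 & regular_list (mono_ideal K us) (rcons vs v).
Proof.
move=> ch srt us0 infK sV rvs ltn ltU.
have [fV cap] := (regular_list_iff ch srt us0 sV).1 rvs.
have vsV : (<<vs>> <= V1)%VS by exact/span_subvP.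
have small (W : {vspace E}) : (\dim W < n)%N -> ~~ (V1 <= W)%VS.
  move=> ltW; apply/negP => /dimvS.
  by rewrite dim_lin cardsT card_ord leqNgt ltW.
have [|v vV nv] := @avoid_subspaces
    (<<vs>>%VS :: [seq (lin K (S U) + <<vs>>)%VS | U <- us]) V1 infK.
  move=> W /[!inE] /orP[/eqP ->|/mapP[U Uus ->]]; apply: small.
    by rewrite (eqP fV).
  by rewrite dimv_disjoint_sum ?cap // dim_lin (eqP fV) ltU.
have nvs := nv _ (mem_head _ _).
exists v => //; apply: (regular_list_chain ch).
- by move=> y; rewrite mem_rcons inE => /orP[/eqP ->|/sV].
- have /perm_free -> : perm_eq (rcons vs v) (v :: vs) by rewrite perm_rcons.
  by rewrite free_cons nvs.
move=> U Uus; apply/eqP; rewrite -subv0; apply/subvP => y /memv_capP[yS].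
have -> : <<rcons vs v>>%VS = (<[v]> + <<vs>>)%VS.
  by rewrite -span_cons; apply/eq_span => z; rewrite mem_rcons.
case/memv_addP => _ /vlineP[a ->] [z zV ey].
have /nv : (lin K (S U) + <<vs>>)%VS \in
    <<vs>>%VS :: [seq (lin K (S U) + <<vs>>)%VS | U <- us].
  by rewrite inE; apply/orP; right; apply/mapP; exists U.
have [a0|a0] := eqVneq a 0.
  move=> _; rewrite -(cap _ Uus); apply/memv_capP; split => //.
  by rewrite ey a0 scale0r add0r.
case/negP; suff : a *: v \in (lin K (S U) + <<vs>>)%VS.
  by rewrite rpredZeq (negPf a0).
rewrite -[a *: v](addrK z) -ey.
by apply: memv_add; rewrite ?rpredN.
Qed.

End Chain.

(** * Comparison of free resolutions *)

Section Augmentation.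
Variables (K : fieldType) (n : nat).
Local Notation E := (exterior K n).

Lemma eaug_is_zmod_morphism : zmod_morphism (@eaug K n).
Proof. by move=> x y; rewrite /eaug ecoefB. Qed.

Lemma eaug_is_monoid_morphism : monoid_morphism (@eaug K n).
Proof.
split=> [|x y]; rewrite /eaug ?ecoef1 ?eqxx // ecoefM (bigD1 set0) ?sub0set //=.
rewrite big1 => [|A /andP[+ nA]]; last by rewrite subset0 (negPf nA).
by rewrite inversions0l expr0 mul1r set0D addr0.
Qed.

HB.instance Definition _ :=
  GRing.isZmodMorphism.Build E K (@eaug K n) eaug_is_zmod_morphism.
HB.instance Definition _ :=
  GRing.isMonoidMorphism.Build E K (@eaug K n) eaug_is_monoid_morphism.

End Augmentation.

Section DependentChoice.
Variables (T : nat -> Type) (P : forall i, T i -> Prop).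
Variable R : forall i, T i -> T i.+1 -> Prop.

(** Dependent choice along a family of types, for building chain maps and homotopies degree by
    degree: P is the invariant that allows the next step, R relates consecutive terms. *)
Lemma dependent_sequence (x0 : T 0) : P x0 ->
    (forall i (x : T i), P x -> exists y : T i.+1, P y /\ R x y) ->
  exists f : forall i, T i, [/\ f 0 = x0, forall i, P (f i) &
    forall i, R (f i) (f i.+1)].
Proof.
move=> P0 step.
pose next i (x : {x : T i | P x}) : {y : T i.+1 | P y} :=
  let y := cid (step i (sval x) (svalP x)) in exist _ (sval y) (svalP y).1.
pose f := fix f i : {x : T i | P x} :=
  if i is j.+1 then next j (f j) else exist _ x0 P0.
exists (fun i => sval (f i)); split=> // i; first exact: svalP (f i).
by rewrite /= /next; case: cid => y [].
Qed.

End DependentChoice.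

(** Exactness is stated for row vectors; choosing a preimage of each row carries it over to
    matrices. *)
Lemma rows_factor (R : pzRingType) (m p q : nat) (B : 'M[R]_(p, q))
    (X : 'M[R]_(m, q)) :
  (forall i, exists y : 'rV_p, row i X = y *m B) -> exists Y, X = Y *m B.
Proof.
move=> h; have [f hf] := fin_all_exists h.
exists (\matrix_i f i); apply/row_matrixP => i.
by rewrite row_mul rowK hf.
Qed.

Lemma mulmx_image_eq0 (R : pzRingType) (m p q : nat) (B : 'M[R]_(m, p))
    (C : 'M[R]_(p, q)) :
  (forall x : 'rV_p, x *m C = 0 <-> exists y : 'rV_m, x = y *m B) ->
  B *m C = 0.
Proof.
move=> h; apply/row_matrixP => i; rewrite row_mul row0; apply/h.
by exists (delta_mx 0 i); rewrite -rowE.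
Qed.

(** f and g compare the complex given by A and B with K^r under zero differentials: f g is homotopic
    to the identity and g f equals it. Hence ker B is the direct sum of im A and im g, and g is
    injective. *)
Lemma rank_homology (K : fieldType) (a b c r : nat) (A : 'M[K]_(a, b))
    (B : 'M[K]_(b, c)) (f : 'M[K]_(b, r)) (g : 'M[K]_(r, b)) h h' :
    A *m B = 0 -> A *m f = 0 -> g *m B = 0 -> g *m f = 1%:M ->
    f *m g - 1%:M = h *m A + B *m h' ->
  (\rank (kermx B) - \rank A)%N = r.
Proof.
move=> AB Af gB gf fg.
have ker : (kermx B :=: A + g)%MS.
  apply/eqmxP/andP; split; last first.
    by rewrite addsmx_sub !sub_kermx AB gB !eqxx.
  have -> : kermx B = kermx B *m f *m g - kermx B *m h *m A.
    have := congr1 (mulmx (kermx B)) fg.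
    rewrite mulmxBr mulmx1 mulmxDr !mulmxA mulmx_ker mul0mx addr0 => <-.
    by rewrite opprB addrCA subrr addr0.
  by rewrite addrC addmx_sub_adds ?submxMl // -mulNmx submxMl.
have cap : (A :&: g = 0)%MS.
  apply/eqP; rewrite -submx0; apply/rV_subP => x.
  rewrite sub_capmx => /andP[/submxP[y ->] /submxP[z e]].
  have /(congr1 (mulmx^~ f)) := e.
  by rewrite -!mulmxA Af gf mulmx0 mulmx1 e => <-; rewrite mul0mx sub0mx.
have rg : \rank g = r.
  by apply/eqP; apply/row_freeP; exists f.
by rewrite ker (mxrank_disjoint_sum cap) rg addKn.
Qed.

Section Comparison.
Variables (K : fieldType) (n : nat).
Local Notation E := (exterior K n).
Variable M : lmodType E.
Implicit Types F G : free_resolution M.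

Lemma bd_lift F i m (X : 'M[E]_(m, rk F i.+1)) :
  X *m bd F i = 0 -> exists Y, X = Y *m bd F i.+1.
Proof.
move=> X0; apply: rows_factor => j; apply/bd_exact.
by rewrite -row_mul X0 row0.
Qed.

Lemma aug_lift F m (X : 'M[E]_(m, rk F 0)) :
  (forall i, aug F (row i X) = 0) -> exists Y, X = Y *m bd F 0.
Proof. by move=> X0; apply: rows_factor => j; apply/aug_exact. Qed.

Lemma bd_bd F i : bd F i.+1 *m bd F i = 0.
Proof. exact/mulmx_image_eq0/bd_exact. Qed.

Lemma aug_bd F x : aug F (x *m bd F 0) = 0.
Proof. by apply/aug_exact; exists x. Qed.

(** The comparison theorem over the identity of M. The invariant is that [bd F i *m f] factors
    through [bd G i]. *)
Lemma chain_lift F G : exists f : forall i, 'M[E]_(rk F i, rk G i),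
  (forall x, aug G (x *m f 0) = aug F x) /\
  (forall i, bd F i *m f i = f i.+1 *m bd G i).
Proof.
have [f0 hf0] : exists f0 : 'M[E]_(rk F 0, rk G 0),
    forall x, aug G (x *m f0) = aug F x.
  have [f hf] := fin_all_exists (fun i => aug_onto G (aug F (delta_mx 0 i))).
  exists (\matrix_i f i) => x; rewrite mulmx_sum_row [in RHS](row_sum_delta x).
  rewrite !linear_sum /=; apply: eq_bigr => i _.
  by rewrite rowK !linearZ /= hf.
have [||f [ef0 _ Rf]] := @dependent_sequence (fun i => 'M[E]_(rk F i, rk G i))
  (fun i f => exists Y, bd F i *m f = Y *m bd G i)
  (fun i f f' => bd F i *m f = f' *m bd G i) f0.
- by apply: aug_lift => i; rewrite row_mul hf0 rowE aug_bd.
- move=> i f [Y eY]; exists Y; split=> //; apply: bd_lift.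
  by rewrite -mulmxA -eY mulmxA bd_bd mul0mx.
by exists f; split=> //; rewrite ef0.
Qed.

Lemma null_homotopy F (f : forall i, 'M[E]_(rk F i)) :
    (forall x, aug F (x *m f 0) = 0) ->
    (forall i, bd F i *m f i = f i.+1 *m bd F i) ->
  exists h : forall i, 'M[E]_(rk F i, rk F i.+1),
    forall i, f i.+1 = h i.+1 *m bd F i.+1 + bd F i *m h i.
Proof.
move=> f0 fS; have [h0 eh0] : exists h0, f 0 = h0 *m bd F 0.
  by apply: aug_lift => i; rewrite rowE f0.
(* The invariant is the homotopy relation in degree i multiplied on the left by [bd F i]; this kills
   the term from the degree below, so it makes sense for i = 0 too. *)
have [||h [_ _ Rh]] := @dependent_sequence (fun i => 'M[E]_(rk F i, rk F i.+1))
  (fun i h => bd F i *m f i = bd F i *m h *m bd F i)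
  (fun i h h' => f i.+1 = h' *m bd F i.+1 + bd F i *m h) h0.
- by rewrite -mulmxA -eh0.
- move=> i h eh; have [|Y eY] := @bd_lift F i _ (f i.+1 - bd F i *m h).
    by rewrite mulmxBl -fS eh subrr.
  exists Y; rewrite -eY subrK; split=> //.
  by rewrite -mulmxA -eY mulmxBr mulmxA bd_bd mul0mx subr0.
by exists h.
Qed.

Lemma homotopy_id F G (f : forall i, 'M[E]_(rk F i, rk G i))
    (g : forall i, 'M[E]_(rk G i, rk F i)) :
    (forall x, aug G (x *m f 0) = aug F x) ->
    (forall x, aug F (x *m g 0) = aug G x) ->
    (forall i, bd F i *m f i = f i.+1 *m bd G i) ->
    (forall i, bd G i *m g i = g i.+1 *m bd F i) ->
  exists h : forall i, 'M[E]_(rk F i, rk F i.+1), forall i,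
    f i.+1 *m g i.+1 - 1%:M = h i.+1 *m bd F i.+1 + bd F i *m h i.
Proof.
move=> f0 g0 fS gS; apply: (@null_homotopy F (fun i => f i *m g i - 1%:M)).
  by move=> x; rewrite mulmxBr mulmx1 linearB /= mulmxA g0 f0 subrr.
move=> i; rewrite mulmxBr mulmxBl mulmx1 mul1mx mulmxA fS -!mulmxA.
by rewrite gS.
Qed.

(** F and G are homotopy equivalent. Over K the differentials of G vanish, so the homotopy on the
    side of G becomes an equality and [rank_homology] applies. *)
Lemma dim_tor_minimal F G i : (forall j, bdK G j = 0) ->
  dim_tor F i.+1 = rk G i.+1.
Proof.
move=> minG; have [f [f0 fS]] := chain_lift F G; have [g [g0 gS]] := chain_lift G F.
have [h hE] := homotopy_id f0 g0 fS gS; have [h' h'E] := homotopy_id g0 f0 gS fS.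
pose a p q (X : 'M[E]_(p, q)) : 'M[K]_(p, q) := map_mx (@eaug K n) X.
have aM p q r (X : 'M[E]_(p, q)) (Y : 'M[E]_(q, r)) : a _ _ (X *m Y) = a _ _ X *m a _ _ Y.
  exact: map_mxM.
apply: (@rank_homology _ _ _ _ _ _ _ (a _ _ (f i.+1)) (a _ _ (g i.+1))
  (a _ _ (h i.+1)) (a _ _ (h i))).
- by rewrite /bdK -aM bd_bd /a map_mx0.
- by rewrite /bdK -aM fS aM [a _ _ (bd G _)](minG i.+1) mulmx0.
- by rewrite /bdK -aM -gS aM [a _ _ (bd G _)](minG i) mul0mx.
- have := congr1 (a _ _) (h'E i); rewrite [RHS]raddfD /= -!/(a _ _ _) !aM.
  rewrite [a _ _ (bd G _)](minG i.+1) [a _ _ (bd G _)](minG i) mulmx0 mul0mx addr0.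
  by rewrite [LHS]map_mxB map_mx1 -/(a _ _ _) aM => /eqP; rewrite subr_eq0 => /eqP.
- have := congr1 (a _ _) (hE i).
  by rewrite [LHS]map_mxB [RHS]map_mxD map_mx1 -!/(a _ _ _) !aM.
Qed.

(** [betti] takes its value from an unspecified resolution; all give the same value, and G itself
    rules out the default. *)
Lemma betti_minimal G i : (forall j, bdK G j = 0) -> betti M i.+1 = rk G i.+1.
Proof.
move=> minG; rewrite /betti; case: classical_sets.xgetP => [b _ [F <-]|no].
  exact: dim_tor_minimal.
by case: (no (rk G i.+1)); exists G; exact: dim_tor_minimal.
Qed.

End Comparison.

(** * Homogeneous matrices and iterated mapping cones *)

Lemma mulmx_scalar_entry (R : pzRingType) m n (X : 'M[R]_(m, n)) a i j :
  (X *m a%:M) i j = X i j * a.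
Proof.
rewrite mxE (bigD1 j) //= !mxE eqxx big1 ?addr0 // => k nk.
by rewrite mxE (negPf nk) mulr0.
Qed.

Section Homogeneous.
Variables (K : fieldType) (n : nat).
Local Notation E := (exterior K n).

(* The entry X i j has degree r i - c j, and vanishes if r i < c j. *)
Definition homog p q (r : 'I_p -> nat) (c : 'I_q -> nat) (X : 'M[E]_(p, q)) :=
  forall i j A, ecoef (X i j) A != 0 -> (#|A| + c j)%N = r i.

Lemma homog0 p q r c : homog r c (0 : 'M[E]_(p, q)).
Proof. by move=> i j A; rewrite mxE ecoef0 eqxx. Qed.

Lemma homog_eq0 p q r c (X : 'M[E]_(p, q)) i j (A : {set 'I_n}) : homog r c X ->
  (#|A| + c j)%N != r i -> ecoef (X i j) A = 0.
Proof. by move=> h; apply: contraNeq => /h ->. Qed.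

Lemma homogN p q r c (X : 'M[E]_(p, q)) : homog r c X -> homog r c (- X).
Proof. by move=> h i j A; rewrite mxE ecoefN oppr_eq0; exact: h. Qed.

Lemma homog_shift p q r c k (X : 'M[E]_(p, q)) : homog r c X ->
  homog (fun i => r i + k)%N (fun j => c j + k)%N X.
Proof. by move=> h i j A /h <-; rewrite addnA. Qed.

Lemma homogM p q s r c d (X : 'M[E]_(p, q)) (Y : 'M[E]_(q, s)) :
  homog r c X -> homog c d Y -> homog r d (X *m Y).
Proof.
move=> hX hY i k C; apply: contraNeq => ne; apply/eqP.
rewrite mxE ecoef_sum big1 // => j _; rewrite ecoefM big1 // => A sAC.
have [->|xA] := eqVneq (ecoef (X i j) A) 0; first by rewrite mulr0 mul0r.
have [->|yA] := eqVneq (ecoef (Y j k) (C :\: A)) 0; first by rewrite mulr0.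
case/eqP: ne; rewrite -(hX _ _ _ xA) -(hY _ _ _ yA) addnA.
by rewrite -(cardsID A C) (setIidPr sAC).
Qed.

Definition homog_part p q (r : 'I_p -> nat) (c : 'I_q -> nat)
    (X : 'M[E]_(p, q)) : 'M[E]_(p, q) :=
  \matrix_(i, j) (([ffun A : {set 'I_n} =>
    if (#|A| + c j)%N == r i then ecoef (X i j) A else 0]
      : {ffun {set 'I_n} -> K^o}) : E).

Lemma ecoef_homog_part p q r c (X : 'M[E]_(p, q)) i j A :
  ecoef (homog_part r c X i j) A =
  if (#|A| + c j)%N == r i then ecoef (X i j) A else 0.
Proof. by rewrite mxE /ecoef ffunE. Qed.

Lemma homog_part_homog p q r c (X : 'M[E]_(p, q)) :
  homog r c (homog_part r c X).
Proof.
by move=> i j A; rewrite ecoef_homog_part; case: ifP => [/eqP //|]; rewrite eqxx.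
Qed.

Lemma homog_partM p q s r c d (Y : 'M[E]_(p, q)) (B : 'M[E]_(q, s)) :
  homog c d B -> homog r d (Y *m B) -> homog_part r c Y *m B = Y *m B.
Proof.
move=> hB hYB; apply/matrixP => i k; apply: ecoefP => C.
have [e|ne] := eqVneq (#|C| + d k)%N (r i); last first.
  by rewrite (homog_eq0 hYB ne) (homog_eq0 _ ne) //; apply: homogM hB;
    exact: homog_part_homog.
rewrite !mxE !ecoef_sum; apply: eq_bigr => j _; rewrite !ecoefM.
apply: eq_bigr => A sAC; have [->|yA] := eqVneq (ecoef (B j k) (C :\: A)) 0.
  by rewrite !mulr0.
rewrite ecoef_homog_part -(hB _ _ _ yA) -e addnA.
by rewrite -(cardsID A C) (setIidPr sAC) eqxx.
Qed.

(** The components of Y of other degrees contribute only to degrees where X vanishes, so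
    [homog_part] of Y is a factor as well. This keeps lifts graded. *)
Lemma homog_factor p q s r c d (X : 'M[E]_(p, s)) (B : 'M[E]_(q, s)) :
    homog c d B -> homog r d X -> (exists Y, X = Y *m B) ->
  exists Y, homog r c Y /\ X = Y *m B.
Proof.
move=> hB hX [Y eY]; exists (homog_part r c Y); split.
  exact: homog_part_homog.
by rewrite (homog_partM hB) // -eY.
Qed.

Lemma parity_homog k (x : E) : (forall A, ecoef x A != 0 -> #|A| = k) ->
  parity x = (-1) ^+ k *: x.
Proof.
move=> h; apply: ecoefP => A; rewrite ecoef_parity ecoefZ.
by have [->|/h ->//] := eqVneq (ecoef x A) 0; rewrite !mulr0.
Qed.

Lemma linear_commutes p q a (v : E) (X : 'M[E]_(p, q)) :
    v \in lin K [set: 'I_n] -> homog (fun=> a) (fun=> a) X ->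
  v%:M *m X = X *m v%:M.
Proof.
move=> vV hX; apply/matrixP => i j; rewrite mul_scalar_mx mxE mulmx_scalar_entry.
rewrite linear_mul // (@parity_homog 0) ?scale1r // => A /hX; lia.
Qed.

(** Supplies the sign in the cone of multiplication by v: v anticommutes with differentials whose
    entries have degree 1. *)
Lemma linear_anticommutes p q a (v : E) (X : 'M[E]_(p, q)) :
    v \in lin K [set: 'I_n] -> homog (fun=> a.+1) (fun=> a) X ->
  v%:M *m X = - (X *m v%:M).
Proof.
move=> vV hX; apply/matrixP => i j.
rewrite mul_scalar_mx [LHS]mxE [RHS]mxE mulmx_scalar_entry linear_mul //.
by rewrite (@parity_homog 1) ?expr1 ?scaleN1r ?mulNr // => A /hX; lia.
Qed.

Definition join_deg p q (r1 : 'I_p -> nat) (r2 : 'I_q -> nat) (i : 'I_(p + q)) :=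
  match split i with inl j => r1 j | inr j => r2 j end.

Lemma homog_col_mx p q s r1 r2 c (X : 'M[E]_(p, s)) (Y : 'M[E]_(q, s)) :
  homog r1 c X -> homog r2 c Y -> homog (join_deg r1 r2) c (col_mx X Y).
Proof.
move=> hX hY i j A; rewrite mxE /join_deg.
by case: split => k; [exact: hX | exact: hY].
Qed.

Lemma homog_row_mx p q s r c1 c2 (X : 'M[E]_(s, p)) (Y : 'M[E]_(s, q)) :
  homog r c1 X -> homog r c2 Y -> homog r (join_deg c1 c2) (row_mx X Y).
Proof.
move=> hX hY i j A; rewrite mxE /join_deg.
by case: split => k; [exact: hX | exact: hY].
Qed.

Lemma homog_eq p q r r' c c' (X : 'M[E]_(p, q)) :
  r =1 r' -> c =1 c' -> homog r c X -> homog r' c' X.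
Proof. by move=> er ec h i j A /h; rewrite er ec. Qed.

Lemma homog_minimal p q r c (X : 'M[E]_(p, q)) : homog r c X ->
  (forall i j, r i != c j) -> map_mx (@eaug K n) X = 0.
Proof.
move=> h ne; apply/matrixP => i j; rewrite !mxE; apply/eqP; apply: contraT.
by move=> /h; rewrite cards0 add0n => e; have := ne i j; rewrite e eqxx.
Qed.

End Homogeneous.

(** * Exactness of mapping cones *)

Section ConeExactness.
Variable R : pzRingType.

(** Z is a condition characterizing the boundaries of C: being a cycle in [cone_exact_block], and
    being a boundary in [cone_exact_col], where it is deduced from the equation at the bottom of the
    cone. *)
Lemma cone_exact f2 f1 f0 c1 c0 (F2 : 'M[R]_(f2, f1)) (F1 : 'M[R]_(f1, f0))
    (p1 : 'M[R]_(c1, f1)) (p0 : 'M[R]_(c0, f0)) (C1 : 'M[R]_(c1, c0))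
    (Z : 'rV[R]_c0 -> Prop) :
    (forall y : 'rV_f1, y *m F1 = 0 <-> exists y' : 'rV_f2, y = y' *m F2) ->
    (forall c : 'rV_c0, Z c <-> exists c' : 'rV_c1, c = c' *m C1) ->
    p1 *m F1 = - (C1 *m p0) ->
  forall (y : 'rV_f1) (c : 'rV_c0),
    (y *m F1 + c *m p0 = 0 /\ Z c) <->
    exists x : 'rV_(f2 + c1), row_mx y c = x *m block_mx F2 0 p1 C1.
Proof.
move=> exF exC anti y c; split=> [[e /exC[c' ec]]|[x]].
  (* Correcting y by the image of c' under [p1] turns it into a cycle of F, by the
     anticommutation. *)
  have [|y' ey] := (exF (y - c' *m p1)).1.
    by rewrite mulmxBl -[X in _ - X]mulmxA anti mulmxN opprK mulmxA -ec.
  exists (row_mx y' c'); rewrite mul_row_block mulmx0 add0r -ec -ey.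
  by rewrite subrK.
rewrite -[x]hsubmxK; set y' := lsubmx x; set c' := rsubmx x.
rewrite mul_row_block mulmx0 add0r => /eq_row_mx[-> ec].
split; last by apply/exC; exists c'.
have FF : y' *m F2 *m F1 = 0 by apply/exF; exists y'.
by rewrite mulmxDl FF add0r -mulmxA anti mulmxN ec mulmxA addNr.
Qed.

Lemma cone_exact_col f2 f1 f0 c1 c0 (F2 : 'M[R]_(f2, f1)) (F1 : 'M[R]_(f1, f0))
    (p1 : 'M[R]_(c1, f1)) (p0 : 'M[R]_(c0, f0)) (C1 : 'M[R]_(c1, c0)) :
    (forall y : 'rV_f1, y *m F1 = 0 <-> exists y' : 'rV_f2, y = y' *m F2) ->
    (forall y (c : 'rV_c0), y *m F1 + c *m p0 = 0 ->
       exists c' : 'rV_c1, c = c' *m C1) ->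
    p1 *m F1 = - (C1 *m p0) ->
  forall x : 'rV_(f1 + c0), x *m col_mx F1 p0 = 0 <->
    exists x' : 'rV_(f2 + c1), x = x' *m block_mx F2 0 p1 C1.
Proof.
move=> exF exC anti x; rewrite -[x]hsubmxK mul_row_col.
set y := lsubmx x; set c := rsubmx x.
rewrite -(cone_exact exF (fun c => conj (@id _) (@id _)) anti y c).
by split=> [e|[]//]; split=> //; exact: exC e.
Qed.

Lemma cone_exact_block f2 f1 f0 c1 c0 c00 (F2 : 'M[R]_(f2, f1))
    (F1 : 'M[R]_(f1, f0)) (p1 : 'M[R]_(c1, f1)) (p0 : 'M[R]_(c0, f0))
    (C1 : 'M[R]_(c1, c0)) (C0 : 'M[R]_(c0, c00)) :
    (forall y : 'rV_f1, y *m F1 = 0 <-> exists y' : 'rV_f2, y = y' *m F2) ->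
    (forall c : 'rV_c0, c *m C0 = 0 <-> exists c' : 'rV_c1, c = c' *m C1) ->
    p1 *m F1 = - (C1 *m p0) ->
  forall x : 'rV_(f1 + c0), x *m block_mx F1 0 p0 C0 = 0 <->
    exists x' : 'rV_(f2 + c1), x = x' *m block_mx F2 0 p1 C1.
Proof.
move=> exF exC anti x; rewrite -[x]hsubmxK.
rewrite mul_row_block mulmx0 add0r -(cone_exact exF exC anti).
split=> [|[-> ->]]; last by rewrite row_mx0.
by rewrite -row_mx0 => /eq_row_mx.
Qed.

End ConeExactness.

(** * Graded resolutions and their cones *)

Section Complexes.
Variables (K : fieldType) (n : nat).
Local Notation E := (exterior K n).
Implicit Types (U S : {set 'I_n}) (J A : {vspace E}) (u x : E).

(* The free module in homological degree 0 has rank one, but crk 0 is only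
   identified with 1 through the mutually inverse matrices cgen and cgenV. *)
Record complex := Complex {
  crk : nat -> nat;
  cbd : forall i, 'M[E]_(crk i.+1, crk i);
  cgen : 'M[E]_(crk 0, 1);
  cgenV : 'M[E]_(1, crk 0);
  cdeg : forall i, 'I_(crk i) -> nat }.
Implicit Types F C : complex.

Definition cval F (x : 'rV[E]_(crk F 0)) : E := (x *m cgen F) 0 0.

(** F is a free resolution of E/J; membership of [cval x] in J replaces vanishing in the
    quotient. *)
Record resolves F J : Prop := Resolves {
  cgenK : cgen F *m cgenV F = 1%:M;
  cgenVK : cgenV F *m cgen F = 1%:M;
  exact_aug : forall x : 'rV_(crk F 0),
    cval x \in J <-> exists y, x = y *m cbd F 0;
  exact_bd : forall i (x : 'rV_(crk F i.+1)),
    x *m cbd F i = 0 <-> exists y, x = y *m cbd F i.+1 }.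

(** Includes minimality. For i = 0 the last field bounds the degrees of the generators of the ideal
    by d, and the bound grows by one in each homological degree. *)
Record graded F (d : nat) : Prop := Graded {
  homog_bd : forall i, homog (@cdeg F i.+1) (@cdeg F i) (cbd F i);
  homog_gen : homog (@cdeg F 0) (fun=> 0%N) (cgen F);
  homog_genV : homog (fun=> 0%N) (@cdeg F 0) (cgenV F);
  minimal_bd : forall i, map_mx (@eaug K n) (cbd F i) = 0;
  deg_le : forall i a, (@cdeg F i.+1 a <= i + d)%N }.

Record linear_complex F : Prop := LinearComplex {
  linear_bd : forall i, homog (fun=> i.+1) (fun=> i) (cbd F i);
  linear_gen : homog (fun=> 0%N) (fun=> 0%N) (cgen F);
  linear_genV : homog (fun=> 0%N) (fun=> 0%N) (cgenV F) }.

Lemma cbd_cbd F J i : resolves F J -> cbd F i.+1 *m cbd F i = 0.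
Proof. by move=> rF; exact/mulmx_image_eq0/(exact_bd rF). Qed.

Lemma cvalD F (x y : 'rV_(crk F 0)) : cval (x + y) = cval x + cval y.
Proof. by rewrite /cval mulmxDl mxE. Qed.

Lemma cvalN F (x : 'rV_(crk F 0)) : cval (- x) = - cval x.
Proof. by rewrite /cval mulNmx mxE. Qed.

Lemma cval_genV F J (a : E) : resolves F J -> cval (a%:M *m cgenV F) = a.
Proof. by move=> rF; rewrite /cval -mulmxA (cgenVK rF) mulmx1 mxE eqxx. Qed.

Definition zero_complex : complex :=
  @Complex (fun i => if i is _.+1 then 0 else 1)%N
    (fun i => 0) 1%:M 1%:M (fun _ _ => 0%N).

Lemma zero_resolves : resolves zero_complex 0.
Proof.
split=> [||x|i x]; rewrite /= ?mulmx1 //; last first.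
  by split=> [_|_]; [exists 0; rewrite mulmx0|]; rewrite thinmx0 ?mul0mx.
rewrite /cval mulmx1 memv0; split=> [/eqP e|[y ->]].
  by exists 0; rewrite mulmx0; apply/rowP => i; rewrite !ord1 e mxE.
by rewrite mulmx0 mxE.
Qed.

Lemma homog1 m : homog (fun=> 0%N) (fun=> 0%N) (1%:M : 'M[E]_m).
Proof.
move=> i j A; rewrite mxE; case: (i == j); last by rewrite ecoef0 eqxx.
rewrite ecoef1; have [->|_] := eqVneq A finset.set0; last by rewrite eqxx.
by rewrite cards0.
Qed.

Lemma zero_graded d : graded zero_complex d.
Proof.
split=> [i|||i|i []] //=; [exact: homog0 | exact: homog1 | exact: homog1 |].
by apply/matrixP => -[].
Qed.

Lemma zero_linear : linear_complex zero_complex.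
Proof. by split=> [i||]; [exact: homog0 | exact: homog1 | exact: homog1]. Qed.

Section Cone.
Variables (F C : complex) (J A J' : {vspace E}) (U : {set 'I_n}).
Variable p : forall i, 'M[E]_(crk C i, crk F i).
Let u := emono K U.

(** The mapping cone of p : C -> F, where p lifts multiplication by e_U: C is shifted by one
    homological degree and, being linear, has C_j placed in degree [j + #|U|]. *)
Definition cone_rk i := if i is j.+1 then (crk F j.+1 + crk C j)%N else crk F 0.

Definition cone_bd i : 'M[E]_(cone_rk i.+1, cone_rk i) :=
  match i with
  | 0 => col_mx (cbd F 0) (p 0)
  | j.+1 => block_mx (cbd F j.+1) 0 (p j.+1) (cbd C j)
  end.

Definition cone_deg i : 'I_(cone_rk i) -> nat :=
  match i with
  | 0 => @cdeg F 0
  | j.+1 => join_deg (@cdeg F j.+1) (fun=> j + #|U|)%N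
  end.

Definition cone := Complex cone_bd (cgen F) (cgenV F) cone_deg.

Hypotheses (rF : resolves F J) (rC : resolves C A).
Hypothesis colonE : forall x, x * u \in J <-> x \in A.
Hypothesis addE : forall x, x \in J' <-> exists a, x - a * u \in J.
Hypothesis p_gen : p 0 *m cgen F = cgen C *m u%:M.
Hypothesis p_bd : forall i, p i.+1 *m cbd F i = - (cbd C i *m p i).

Lemma cval_p (c : 'rV_(crk C 0)) : cval (c *m p 0) = cval c * u.
Proof. by rewrite /cval -mulmxA p_gen mulmxA mulmx_scalar_entry. Qed.

Lemma cone_exact_aug (x : 'rV_(crk F 0)) : cval x \in J' <->
  exists y : 'rV_(crk F 1 + crk C 0), x = y *m col_mx (cbd F 0) (p 0).
Proof.
split=> [/addE[a xa]|[y ->]].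
  pose c := a%:M *m cgenV C.
  have /(exact_aug rF)[y ey] : cval (x - c *m p 0) \in J.
    by rewrite cvalD cvalN cval_p (cval_genV _ rC).
  by exists (row_mx y c); rewrite mul_row_col -ey subrK.
rewrite -[y]hsubmxK mul_row_col; apply/addE; exists (cval (rsubmx y)).
by rewrite -cval_p cvalD addrK; apply/(exact_aug rF); exists (lsubmx y).
Qed.

Lemma cone_resolves : resolves cone J'.
Proof.
split=> [||x|[|i] x]; [exact: cgenK rF | exact: cgenVK rF | | |].
- exact: cone_exact_aug.
- apply: (cone_exact_col (F2 := cbd F 1) (exact_bd rF (i := 0%N)) _ (p_bd 0)).
  move=> y c e; apply/(exact_aug rC)/colonE; rewrite -cval_p.
  have -> : c *m p 0 = - (y *m cbd F 0) by apply/eqP; rewrite -addr_eq0 addrC e.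
  by rewrite cvalN rpredN; apply/(exact_aug rF); exists y.
- exact: (cone_exact_block (exact_bd rF (i := i.+1)) (exact_bd rC (i := i))
    (p_bd i.+1)).
Qed.

(** For minimality: [p i.+1] maps generators of degree [i.+1 + #|U|] to generators of degree at most
    [i + d], so its entries have no constant term; [p 0] factors through e_U, of positive degree. *)
Lemma cone_graded d : graded F d -> linear_complex C -> (d <= #|U|)%N ->
    (0 < #|U|)%N ->
    (forall i, homog (fun=> i + #|U|)%N (@cdeg F i) (p i)) ->
    (p 0 = cgen C *m u%:M *m cgenV F) ->
  graded cone #|U|.
Proof.
move=> gF lC le_d U0 hp ep.
have minC i : map_mx (@eaug K n) (cbd C i) = 0.
  by apply: (homog_minimal (linear_bd lC (i := i))) => *; rewrite eqn_leq ltnn.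
split=> [[|i]|||[|i]|[|i] a] /=.
- by apply: homog_col_mx; [exact: homog_bd gF 0%N | exact: hp].
- apply: homog_col_mx; apply: homog_row_mx; [exact: homog_bd gF i.+1 | |
    exact: hp |].
    exact: homog0.
  exact: (homog_shift (#|U|) (linear_bd lC (i := i))).
- exact: homog_gen gF.
- exact: homog_genV gF.
- rewrite map_col_mx (minimal_bd gF) ep !map_mxM.
  have -> : map_mx (@eaug K n) (u%:M : 'M_1) = 0.
    apply/matrixP => i j; rewrite !mxE !ord1 eqxx mulr1n /u emonoE /eaug.
    by rewrite ecoef_ebasis; case: eqP => // e; rewrite -e cards0 in U0.
  by rewrite mulmx0 mul0mx col_mx0.
- rewrite map_block_mx (minimal_bd gF) map_mx0 minC.
  rewrite (homog_minimal (@hp i.+1)) ?block_mx0 // => a b.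
  have := deg_le gF b; rewrite neq_ltn => le_b; apply/orP; right.
  by rewrite addSn ltnS (leq_trans le_b) // leq_add2l.
- rewrite /join_deg; case: split => b; last by [].
  by apply: leq_trans (deg_le gF b) _.
- rewrite /join_deg; case: split => b; last by [].
  by apply: leq_trans (deg_le gF b) _; rewrite leq_add2l.
Qed.

End Cone.

End Complexes.

(** * The Cartan resolution and the resolution by iterated cones *)

Section Cartan.
Variables (K : fieldType) (n : nat).
Local Notation E := (exterior K n).
Implicit Types (U S : {set 'I_n}) (J A : {vspace E}) (u x : E).
Implicit Types F C : complex K n.

Section CartanStep.
Variables (F : complex K n) (J J' : {vspace E}) (k : 'I_n).
Local Notation e := (evar K k).

Fixpoint cartan_rk i := if i is j.+1 then (crk F j.+1 + cartan_rk j)%N else crk F 0.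

(** The projection of the new complex onto F followed by multiplication by e_k. *)
Definition cartan_proj i : 'M[E]_(cartan_rk i, crk F i) :=
  match i with 0 => e%:M | j.+1 => col_mx e%:M 0 end.

Fixpoint cartan_bd i : 'M[E]_(cartan_rk i.+1, cartan_rk i) :=
  match i with
  | 0 => col_mx (cbd F 0) (cartan_proj 0)
  | j.+1 => block_mx (cbd F j.+1) 0 (cartan_proj j.+1) (cartan_bd j)
  end.

(* The cone of e_k : C -> F for C the complex itself: adjoining e_k to the
   sequence adds the divided powers of one more variable. *)
Definition cartan := Complex cartan_bd (cgen F) (cgenV F) (fun i _ => i).

Hypotheses (rF : resolves F J) (lF : linear_complex F).
Hypothesis colonE : forall x, x * e \in J <-> x \in J'.
Hypothesis addE : forall x, x \in J' <-> exists a, x - a * e \in J.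

Let eV : e \in lin K [set: 'I_n].
Proof. by apply: memv_span; rewrite map_f // mem_enum inE. Qed.

Let cval_e (c : 'rV_(crk F 0)) : cval (c *m e%:M) = cval c * e.
Proof.
rewrite /cval -mulmxA (linear_commutes eV (linear_gen lF)) mulmxA.
by rewrite mulmx_scalar_entry.
Qed.

Let ee m : (e%:M : 'M[E]_m) *m e%:M = 0.
Proof. by rewrite -scalar_mxM evar_sqr; apply/matrixP => a b; rewrite !mxE mul0rn. Qed.

Let proj_e i : cartan_proj i *m e%:M = 0.
Proof. by case: i => [|i]; rewrite /= ?mul_col_mx ee ?mul0mx ?col_mx0. Qed.

Let proj_bd i : cartan_proj i.+1 *m cbd F i = - (cartan_bd i *m cartan_proj i).
Proof.
rewrite /= mul_col_mx mul0mx (linear_anticommutes eV (linear_bd lF (i := i))).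
case: i => [|i] /=; first by rewrite mul_col_mx ee opp_col_mx oppr0.
rewrite mul_block_col !mulmx0 !addr0 -[col_mx _ _ *m _]/(cartan_proj i.+1 *m _).
by rewrite proj_e opp_col_mx oppr0.
Qed.

Let cartan_exact_aug (x : 'rV_(crk F 0)) : cval x \in J' <->
  exists y : 'rV_(crk F 1 + crk F 0), x = y *m cartan_bd 0.
Proof.
split=> [/addE[a xa]|[y ->]] /=.
  pose c := a%:M *m cgenV F.
  have /(exact_aug rF)[y ey] : cval (x - c *m e%:M) \in J.
    by rewrite cvalD cvalN cval_e (cval_genV _ rF).
  by exists (row_mx y c); rewrite mul_row_col -ey subrK.
rewrite -[y]hsubmxK mul_row_col; apply/addE; exists (cval (rsubmx y)).
by rewrite -cval_e cvalD addrK; apply/(exact_aug rF); exists (lsubmx y).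
Qed.

(** As J : e_k and J + (e_k) are both J', the new complex resolves both ends of 0 -> E/J' -> E/J ->
    E/J' -> 0. Exactness of the cone in one degree needs that of the same complex one degree lower,
    hence the induction. *)
Lemma cartan_resolves : resolves cartan J'.
Proof.
split=> [||x|i]; [exact: cgenK rF | exact: cgenVK rF | |].
  exact: cartan_exact_aug.
elim: i => [|i IHi] x.
  apply: (cone_exact_col (F2 := cbd F 1) (exact_bd rF (i := 0%N)) _ (proj_bd 0)).
  move=> y c ec; apply/cartan_exact_aug/colonE; rewrite -cval_e.
  have -> : c *m e%:M = - (y *m cbd F 0).
    by apply/eqP; rewrite -addr_eq0 addrC; apply/eqP.
  by rewrite cvalN rpredN; apply/(exact_aug rF); exists y.
exact: (cone_exact_block (exact_bd rF (i := i.+1)) IHi (proj_bd i.+1)).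
Qed.

Let homog_e m i : homog (fun=> i.+1) (fun=> i) (e%:M : 'M[E]_m).
Proof.
move=> a b A; rewrite mxE; case: (a == b); last by rewrite ecoef0 eqxx.
rewrite ecoef_ebasis; have [->|_] := eqVneq A [set k]; last by rewrite eqxx.
by rewrite cards1.
Qed.

Lemma cartan_linear : linear_complex cartan.
Proof.
split; [|exact: linear_gen lF|exact: linear_genV lF].
have hj p q i : join_deg (p := p) (q := q) (fun=> i) (fun=> i) =1 fun=> i.
  by move=> a; rewrite /join_deg; case: split.
have hp i : homog (fun=> i.+1) (fun=> i) (cartan_proj i).
  case: i => [|i] /=; first exact: homog_e.
  apply: (homog_eq (hj _ _ _) (fun=> erefl)); apply: homog_col_mx.
    exact: homog_e.
  exact: homog0.
elim=> [|i IHi] /=; apply: (homog_eq (hj _ _ _) (fun=> erefl));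
  apply: homog_col_mx.
- exact: (linear_bd lF (i := 0%N)).
- exact: homog_e.
- apply: (homog_eq (fun=> erefl) (hj _ _ _)); apply: homog_row_mx.
    exact: (linear_bd lF (i := i.+1)).
  exact: homog0.
- apply: (homog_eq (fun=> erefl) (hj _ _ _)); apply: homog_row_mx.
    exact: (hp i.+1).
  by apply: homog_eq (homog_shift 1 IHi) => a; rewrite addn1.
Qed.

End CartanStep.

Lemma disjoint_setU1r (A S : {set 'I_n}) k :
  [disjoint A & k |: S] = (k \notin A) && [disjoint A & S].
Proof.
by rewrite -!setI_eq0 setIUr setU_eq0 [A :&: [set k]]setIC setI_eq0 disjoints1.
Qed.

Lemma mem_evar_idealU1 S k x :
  x \in evar_ideal K (k |: S) <-> exists a, x - a * evar K k \in evar_ideal K S.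
Proof.
pose s := [seq [set i] | i <- enum S].
have -> : evar_ideal K S = mono_ideal K s by exact: evar_idealE.
rewrite -[evar K k]emonoE -mono_ideal_rcons.
have e (A : {set 'I_n}) : has (fun B : {set 'I_n} => B \subset A)
    (rcons s [set k]) = ~~ [disjoint A & k |: S].
  rewrite has_rcons sub1set disjoint_setU1r negb_and negbK.
  congr (_ || _).
  apply/hasP/pred0Pn => [[B /mapP[i iS ->]]|[i /andP[iA iS]]].
    by rewrite sub1set => iA; exists i; rewrite /= iA -mem_enum.
  by exists [set i]; rewrite ?sub1set // map_f ?mem_enum.
split=> [/mem_evar_ideal h|/mem_mono_ideal h].
  by apply/mem_mono_ideal => A /h; rewrite e.
by apply/mem_evar_ideal => A /h; rewrite e.
Qed.

(** Together with [mem_evar_idealU1] this provides the two hypotheses of the Cartan step, with the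
    same ideal J'. *)
Lemma colon_evar_ideal S k x : k \notin S ->
  x * evar K k \in evar_ideal K S <-> x \in evar_ideal K (k |: S).
Proof.
move=> kS; split=> [/mem_evar_ideal h|/mem_evar_ideal h].
  apply/mem_evar_ideal => A xA; rewrite disjoint_setU1r negb_and negbK.
  have [//|kA /=] := boolP (k \in A).
  have := h (k |: A); rewrite ecoef_mul_ebasis sub1set setU11.
  have -> : (k |: A) :\: [set k] = A by rewrite setU1K.
  rewrite mulf_eq0 signr_eq0 (negPf xA) => /(_ isT).
  by rewrite disjoint_sym disjoint_setU1r kS /= disjoint_sym.
apply/mem_evar_ideal => A; rewrite ecoef_mul_ebasis.
case: ifP; last by rewrite eqxx.
rewrite mulf_eq0 signr_eq0 => _ /h; apply: contraNN => dA.
by rewrite disjoint_setU1r setD11 (disjointWl (subsetDl _ _) dA).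
Qed.

(** One Cartan step per variable in S; the ranks add up by Pascal's rule. *)
Lemma evar_ideal_resolution S : exists C, [/\ resolves C (evar_ideal K S),
  linear_complex C & forall i, crk C i = 'C((i + #|S|).-1, i)].
Proof.
move e: #|S| => m; elim: m S e => [|m IHm] S e.
  have -> : S = set0 by apply/eqP; rewrite -cards_eq0 e.
  exists (zero_complex K n); rewrite evar_ideal0; split; [exact: zero_resolves | exact: zero_linear |].
  (* For empty S the truncated predecessor gives C(0, 0) = 1 in degree 0 and C(i, i + 1) = 0 in
     degree i + 1. *)
  by case=> [|i]; rewrite addn0 ?bin0 //= bin_small.
have [k kS'] : exists k, k \in S by apply/card_gt0P; rewrite e.
rewrite -(setD1K kS'); have kS : k \notin S :\ k by rewrite setD11.
have [|C [rC lC eC]] := IHm (S :\ k).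
  by move: e; rewrite (cardsD1 k) kS' => -[].
exists (cartan C k); split.
- apply: (cartan_resolves rC lC) => x; first exact: colon_evar_ideal.
  exact: mem_evar_idealU1.
- exact: cartan_linear.
move=> i; elim: i => [|i IHi] /=; first by rewrite eC !bin0.
by rewrite -[cartan_rk C i]/(crk (cartan C k) i) IHi eC addSn addnS /= binS.
Qed.

(** Multiplication by e_U maps E/A to E/J and lifts degree by degree, with homogeneous lifts by
    [homog_factor]. The sign of the cone is put into p. *)
Lemma cone_lift F C J A U d : resolves F J -> graded F d -> resolves C A ->
    linear_complex C -> (forall x, x * emono K U \in J <-> x \in A) ->
  exists p : forall i, 'M[E]_(crk C i, crk F i),
    [/\ p 0 = cgen C *m (emono K U)%:M *m cgenV F,
        forall i, homog (fun=> i + #|U|)%N (@cdeg _ _ F i) (p i) &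
        forall i, p i.+1 *m cbd F i = - (cbd C i *m p i)].
Proof.
move=> rF gF rC lC cE; pose p0 := cgen C *m (emono K U)%:M *m cgenV F.
have [||p [ep Pp Rp]] := @dependent_sequence (fun i => 'M[E]_(crk C i, crk F i))
  (fun i p => homog (fun=> i + #|U|)%N (@cdeg _ _ F i) p /\
              exists Y, cbd C i *m p = Y *m cbd F i)
  (fun i p p' => p' *m cbd F i = - (cbd C i *m p)) p0.
- split.
    apply: homogM (homog_genV gF); apply: homogM (homog_shift #|U| (linear_gen lC)) _.
    move=> a b A'; rewrite !ord1 mxE eqxx emonoE ecoef_ebasis.
    by have [->|_] := eqVneq A' U; rewrite ?eqxx // addn0.
  apply: rows_factor => j; apply/(exact_aug rF).
  rewrite row_mul /p0 /cval -!mulmxA (cgenVK rF) mulmx1 mulmxA.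
  rewrite mulmx_scalar_entry; apply/cE/(exact_aug rC).
  by exists (delta_mx 0 j); rewrite rowE.
- move=> i p [hp ex].
  have [Y [hY eY]] := homog_factor (homog_bd gF (i := i))
    (homogM (homog_shift #|U| (linear_bd lC (i := i))) hp) ex.
  exists (- Y); split; last by rewrite mulNmx eY.
  split; first exact: homogN.
  apply: rows_factor => j; apply/(exact_bd rF).
  rewrite -row_mul -mulmxA mulNmx -eY mulmxN mulmxA (cbd_cbd i rC) mul0mx.
  by rewrite oppr0 row0.
by exists p; split=> // i; case: (Pp i).
Qed.

Lemma graded_le F d d' : (d <= d')%N -> graded F d -> graded F d'.
Proof.
move=> le_d [? ? ? ? h]; split=> // i a.
by apply: leq_trans (h i a) _; rewrite leq_add2l.
Qed.

Lemma chain_resolution (S : {set 'I_n} -> {set 'I_n}) us d : colon_chain K S us ->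
    sorted leq [seq #|U| | U : {set 'I_n} <- us] -> set0 \notin us ->
    (forall U, U \in us -> #|U| <= d)%N ->
  exists F, [/\ resolves F (mono_ideal K us), graded F d &
    forall i, crk F i.+1 = (\sum_(U <- us) 'C((i + #|S U|).-1, i))%N].
Proof.
elim/last_ind: us d => [|us U IHus] d ch srt us0 le_d.
  exists (zero_complex K n); rewrite mono_ideal_nil.
  by split; [exact: zero_resolves | exact: zero_graded | move=> i; rewrite big_nil].
have le_U T : T \in us -> (#|T| <= #|U|)%N.
  move=> Tus; move: srt; rewrite map_rcons -cats1 (sorted_pairwise leq_trans).
  by rewrite pairwise_cat allrel1r => /and3P[/allP h _ _]; apply: h; rewrite map_f.
have srt' : sorted leq [seq #|T| | T : {set 'I_n} <- us].
  by move: srt; rewrite map_rcons -cats1 => /cat_sorted2[].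
move: us0; rewrite mem_rcons inE negb_or => /andP[U0 us0].
(* The induction hypothesis is used with bound [#|U|], which dominates all earlier degrees by
   sortedness; this makes the cone minimal. *)
have [F [rF gF eF]] := IHus _ (colon_chain_rcons ch) srt' us0 le_U.
have [C [rC lC eC]] := evar_ideal_resolution (S U).
have cE x : x * emono K U \in mono_ideal K us <-> x \in evar_ideal K (S U).
  by rewrite (ch us U [::]) ?cats1.
have [p [ep hp Rp]] := cone_lift rF gF rC lC cE.
have p_gen : p 0 *m cgen F = cgen C *m (emono K U)%:M.
  by rewrite ep -!mulmxA (cgenVK rF) mulmx1.
exists (cone U p); split.
- by apply: (cone_resolves rF rC cE _ p_gen Rp); exact: mono_ideal_rcons.
- apply: (@graded_le _ #|U|); first by rewrite le_d // mem_rcons inE eqxx.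
  apply: (cone_graded gF lC _ _ hp ep) => //.
  by rewrite card_gt0 eq_sym.
- by move=> i; rewrite -cats1 big_cat big_seq1 /= eF eC.
Qed.

End Cartan.

(** * Depth and Betti numbers of the quotient *)

From mathcomp Require Import classical_sets cardinality reals ereal
  constructive_ereal.

Section QuotientDepth.
Variables (K : fieldType) (n : nat) (I : ideal K n).
Local Notation E := (exterior K n).
Local Notation M := (equot I).
Local Notation V1 := (lin K [set: 'I_n]).
Implicit Types (x y v : E) (vs : seq E) (J : {vspace E}).

Lemma scale_epi x y : x *: epi I y = epi I (x * y).
Proof. exact: equot_scaleE. Qed.

Lemma epi_surj (m : M) : exists x, m = epi I x.
Proof. by exists (repr m); rewrite epiK. Qed.

Lemma epi0 : epi I 0 = 0.
Proof. by apply: (addrI (epi I 0)); rewrite -epiD !addr0. Qed.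

Lemma epiN x : epi I (- x) = - epi I x.
Proof. by apply: (addrI (epi I x)); rewrite -epiD !subrr epi0. Qed.

Lemma epi_sum (J : Type) (r : seq J) (F : J -> E) :
  epi I (\sum_(j <- r) F j) = \sum_(j <- r) epi I (F j).
Proof.
by elim/big_rec2: _ => [|j y x _ <-]; rewrite ?epi0 ?epiD.
Qed.

Lemma is_ideal_ideal : is_ideal I.
Proof. by split; [exact: ideal_mull | exact: ideal_mulr]. Qed.

(** J (E/I) is (I + J)/I: as J is two-sided, a sum of multiples of classes lifts to one element of
    J, and j in J acts on the class of 1. *)
Lemma ideal_smulE J x : is_ideal J ->
  ideal_smul J (epi I x) <-> x \in (I + J)%VS.
Proof.
move=> [Jl Jr]; split=> [[k [a [p [aJ e]]]]|/memv_addP[i iI [j jJ ->]]].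
  have {}e : epi I x = epi I (\sum_(l < k) a l * repr (p l)).
    by rewrite e epi_sum; apply: eq_bigr => l _; rewrite -scale_epi epiK.
  move/eqP: e; rewrite epi_eq => e; rewrite -[x](subrK (\sum_l a l * repr (p l))).
  by apply: memv_add => //; apply: memv_suml => l _; apply: Jr.
exists 1%N, (fun=> j), (fun=> epi I 1); split=> //.
rewrite big_ord_recl big_ord0 addr0 scale_epi mulr1 addrC; apply/eqP.
by rewrite epi_eq addrAC subrr add0r.
Qed.

Lemma regular_modE J v : is_ideal J -> v \in V1 ->
  regular_mod (ideal_smul J (M := M)) v <-> regular (I + J)%VS v.
Proof.
move=> JI vV; have IJ := ideal_add is_ideal_ideal JI.
have e x y : epi I x - v *: epi I y = epi I (x - v * y).
  by rewrite scale_epi -epiN -epiD.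
split=> [h|/(regularP IJ vV) h m].
  apply/(regularP IJ vV) => x vx.
  have [+ _] := h (epi I x); rewrite scale_epi ideal_smulE // => /(_ vx)[p].
  by have [y ->] := epi_surj p; rewrite e ideal_smulE // => ?; exists y.
have [x ->] := epi_surj m; rewrite scale_epi ideal_smulE //.
split=> [/h[y xy]|[p]]; first by exists (epi I y); rewrite e ideal_smulE.
have [y ->] := epi_surj p; rewrite e ideal_smulE // => xy.
have := IJ.1 v _ xy; rewrite mulrBr mulrA linear_sqr //.
by rewrite mul0r subr0.
Qed.

Lemma regular_list_nth J vs : {subset vs <= V1} ->
  regular_list J vs <->
  forall i, (i < size vs)%N -> regular (J + ideal_gen (take i vs))%VS vs`_i.
Proof.
elim: vs J => [|v vs IHvs] J sV /=; first by split.
have vV : v \in V1 by apply: sV; rewrite inE eqxx.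
have sV' : {subset vs <= V1} by move=> y ys; apply: sV; rewrite inE ys orbT.
split=> [/andP[rv /(IHvs _ sV') h] [|i] lti|h] /=.
- by rewrite ideal_gen_nil addv0.
- by rewrite ideal_gen_cons // addvA; apply: h.
have := h 0%N isT; rewrite /= ideal_gen_nil addv0 => ->.
apply/IHvs => // i lti; have := h i.+1 lti.
by rewrite /= ideal_gen_cons // addvA.
Qed.

Lemma regular_seqE vs :
  regular_seq M vs <->
  [/\ {subset vs <= V1}, regular_list I vs & (I + ideal_gen vs != fullv)%VS].
Proof.
have top : (exists m : M, ~ ideal_smul (ideal_gen vs) m) <->
    (I + ideal_gen vs != fullv)%VS.
  split=> [[m]|].
    have [x ->] := epi_surj m; rewrite ideal_smulE ?/is_ideal; last first.
      exact: ideal_gen_ideal.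
    by apply: contra_notN => /eqP ->; rewrite memvf.
  move=> nT; have : ~~ (fullv <= I + ideal_gen vs)%VS.
    by apply: contraNN nT => h; rewrite eqEsubv subvf.
  case/subvPn => x _ nx; exists (epi I x); rewrite ideal_smulE.
    exact/negP.
  exact: ideal_gen_ideal.
split=> [[lin_vs reg /top nT]|[sV reg /top nT]]; split=> //.
- by move=> v /lin_vs /linear_formE.
- have sV : {subset vs <= V1} by move=> v /lin_vs /linear_formE.
  apply/regular_list_nth => // i lti; apply/regular_modE; last exact: reg.
    exact: ideal_gen_ideal.
  by apply: sV; rewrite mem_nth.
- by move=> v vs_v; apply/linear_formE/sV.
- move=> i lti; apply/regular_modE; first exact: ideal_gen_ideal.
    by apply: sV; rewrite mem_nth.
  exact: (regular_list_nth _ sV).1.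
Qed.

(** Regular sequences have length at most d because of [U0], and every shorter one extends. So the
    maximal ones are exactly those of length d, and they exist. *)
Lemma depth_chain S us (d : nat) :
    (I : {vspace E}) = mono_ideal K us -> colon_chain K S us ->
    sorted leq [seq #|U| | U : {set 'I_n} <- us] -> finset.set0 \notin us ->
    (forall s : seq K, exists a, a \notin s) ->
    (forall U, U \in us -> (#|S U| + d <= n)%N) ->
    (exists2 U, U \in us & (#|S U| + d = n)%N) ->
  depth M = d.
Proof.
move=> eI ch srt us0 infK le_d [U0 U0us eU0].
have regE vs : regular_seq M vs <-> {subset vs <= V1} /\
    regular_list (mono_ideal K us) vs.
  rewrite regular_seqE eI; split=> [[]//|[sV r]]; split=> //.
  exact: proper_add.
have le_size vs : regular_seq M vs -> (size vs <= d)%N.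
  move=> /regE[sV r].
  rewrite -(leq_add2l #|S U0|) eU0.
  exact: (regular_list_size ch srt us0 sV r).
have ext vs : regular_seq M vs -> (size vs < d)%N ->
    exists v, regular_seq M (rcons vs v).
  move=> /regE[sV r] lt_d; have [||v vV rv] := regular_list_extend ch srt us0 infK sV r.
  - by apply: leq_trans lt_d _; apply: leq_trans (le_d _ U0us); exact: leq_addl.
  - by move=> U Uus; apply: leq_trans (le_d U Uus); rewrite -addnS leq_add2l.
  exists v; apply/regE; split=> // y.
  by rewrite mem_rcons inE => /orP[/eqP ->|/sV].
have ex m : (m <= d)%N -> exists2 vs, regular_seq M vs & size vs = m.
  elim: m => [_|m IHm lt_m]; first by exists [::] => //; apply/regE.
  have [vs rvs szm] := IHm (ltnW lt_m).
  have [|v rv] := ext vs rvs; first by rewrite szm.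
  by exists (rcons vs v); rewrite // size_rcons szm.
have uniq_d e : (exists2 vs, maximal_regular_seq M vs & size vs = e) -> e = d.
  case=> vs [rvs maxvs] <-; apply/eqP; rewrite eqn_leq le_size //= leqNgt.
  by apply/negP => /(ext _ rvs)[v /maxvs].
rewrite /depth; case: xgetP => [e _ [vs mvs sz]|no].
  by apply: uniq_d; exists vs.
have [vs rvs sz] := ex d (leqnn d).
case: (no d); exists vs => //; split=> // v /le_size.
by rewrite size_rcons sz ltnn.
Qed.

End QuotientDepth.

(** * The minimal resolution of the quotient *)

Section QuotientResolution.
Variables (K : fieldType) (n : nat) (I : ideal K n).
Local Notation E := (exterior K n).
Variable F : complex K n.
Hypothesis rF : resolves F I.

Definition quotient_aug (x : 'rV[E]_(crk F 0)) : equot I := epi I (cval x).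

Lemma quotient_aug_is_linear : linear quotient_aug.
Proof.
move=> a x y; rewrite /quotient_aug /cval mulmxDl -scalemxAl !mxE epiD.
by rewrite scale_epi.
Qed.

HB.instance Definition _ := GRing.isLinear.Build E 'rV[E]_(crk F 0) (equot I)
  *:%R quotient_aug quotient_aug_is_linear.

Lemma quotient_aug_onto m : exists x, quotient_aug x = m.
Proof.
have [x ->] := epi_surj m; exists (x%:M *m cgenV F).
by rewrite /quotient_aug (cval_genV _ rF).
Qed.

Lemma quotient_aug_exact x :
  quotient_aug x = 0 <-> exists y, x = y *m cbd F 0.
Proof.
rewrite -(exact_aug rF) /quotient_aug -(epi0 I); split=> [/eqP|h].
  by rewrite epi_eq subr0.
by apply/eqP; rewrite epi_eq subr0.
Qed.

Definition quotient_resolution : free_resolution (equot I) :=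
  @FreeResolution _ _ (equot I) (crk F) (@cbd _ _ F) quotient_aug
    quotient_aug_onto quotient_aug_exact (exact_bd rF).

Lemma betti_quotient d i : graded F d -> betti (equot I) i.+1 = crk F i.+1.
Proof.
move=> gF; apply: (betti_minimal (G := quotient_resolution)) => j.
exact: (minimal_bd gF).
Qed.

End QuotientResolution.

(** * Complexity *)

Lemma ffact_le_expn N m : (N ^_ m <= N ^ m)%N.
Proof.
elim: m N => [|m IHm] N; first by rewrite ffactn0.
rewrite ffactnS expnS leq_mul2l; apply/orP; right.
apply: leq_trans (IHm _) _.
by case: (m) => // l; rewrite leq_exp2r ?leq_pred.
Qed.

Lemma expn_le_ffact k m : (k.+1 ^ m <= (k + m) ^_ m)%N.
Proof.
elim: m => [|m IHm]; first by rewrite ffactn0.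
by rewrite addnS ffactnS expnS leq_mul // ltnS leq_addr.
Qed.

(** Written as C(i + s - 1, s - 1), the binomial is a polynomial in i of degree s - 1; [expn_le_bin]
    is the matching lower bound. *)
Lemma bin_le_expn i s n : (0 < s <= n)%N ->
  ('C((i + s).-1, i) <= (n * i.+1) ^ s.-1)%N.
Proof.
case: s => // s /= le_sn; rewrite addnS /= -bin_sub ?leq_addr // addKn.
apply: (@leq_trans ((i + s) ^_ s)).
  by rewrite -bin_ffact leq_pmulr // fact_gt0.
apply: leq_trans (ffact_le_expn _ _) _.
have le : (i + s <= n * i.+1)%N.
  apply: (@leq_trans (s.+1 * i.+1)); last by rewrite leq_mul2r le_sn orbT.
  by rewrite mulSn; nia.
by case: s le_sn le => // s _ le; rewrite leq_exp2r.
Qed.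

Lemma expn_le_bin i s : (0 < s)%N ->
  (i.+1 ^ s.-1 <= s.-1`! * 'C((i + s).-1, i))%N.
Proof.
case: s => // s _; rewrite addnS /= -bin_sub ?leq_addr // addKn.
by rewrite mulnC bin_ffact; exact: expn_le_ffact.
Qed.

(** The exponent c + 1 qualifies by [ub]. A smaller d would give (k + 1)^c <= B alpha (k + 1)^(c -
    1) for all k, with an integer exponent that is -1 for c = 0. *)
Lemma polynomial_growth (R : realType) (b : nat -> nat) (c A B : nat) :
    (forall k, (b k.+1 <= A * k.+1 ^ c)%N) ->
    (forall k, (k.+1 ^ c <= B * b k.+1)%N) ->
  ereal_inf [set (d%:~R)%:E | d in [set d : int | exists alpha : R,
    forall i : nat, (1 <= i)%N -> (b i)%:R <= alpha * (i%:R : R) ^ (d - 1)]]%classic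
  = (c.+1%:R)%:E :> \bar R.
Proof.
move=> ub lb; apply/eqP; rewrite eq_le; apply/andP; split.
  apply: ereal_inf_lbound; exists c.+1%:Z; last by rewrite pmulrn.
  exists A%:R => -[//|i] _.
  have -> : (c.+1%:Z - 1 = c%:Z)%R by rewrite -addn1 PoszD addrK.
  by rewrite -exprnP -natrX -natrM ler_nat.
apply: le_ereal_inf_tmp => _ [d [alpha hd] <-].
rewrite lee_fin leNgt pmulrn ltr_int; apply/negP => lt_d.
have alpha0 : 0 <= alpha.
  by have := hd 1%N isT; rewrite exp1rz mulr1; apply: le_trans.
(* By the Archimedean property k + 1 exceeds B alpha. *)
pose k := Num.bound (B%:R * alpha : R).
have k0 : (k.+1%:R : R) != 0 by rewrite pnatr_eq0.
have : (k.+1%:R : R) ^+ c <= B%:R * alpha * k.+1%:R ^ (c%:Z - 1).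
  apply: (@le_trans _ _ (B%:R * (b k.+1)%:R)).
    by rewrite -natrX -natrM ler_nat.
  rewrite -mulrA ler_wpM2l //; apply: le_trans (hd k.+1 isT) _.
  rewrite ler_wpM2l // ler_weXz2l ?ler1n //.
  by rewrite lerD2r; lia.
have {1}-> : (k.+1%:R : R) ^+ c = k.+1%:R * k.+1%:R ^ (c%:Z - 1).
  by rewrite -{2}[k.+1%:R]expr1z -expfzDr // addrCA subrr addr0.
rewrite ler_pM2r ?exprz_gt0 ?ltr0n // leNgt => /negP; apply.
apply: lt_le_trans (archi_boundP _) _; first by rewrite mulr_ge0.
by rewrite ler_nat.
Qed.

Lemma infinite_avoid (T : choiceType) : infinite_set [set: T]%classic ->
  forall s : seq T, exists a, a \notin s.
Proof.
move=> infT s; apply: contrapT => no; apply: infT; apply/finite_seqP.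
exists s; apply/seteqP; split=> // x _ /=; apply: contrapT => /negP xs.
by apply: no; exists x.
Qed.

(** * From linear quotients to the two formulas *)

Section LinearQuotients.
Variables (K : fieldType) (n : nat).
Local Notation E := (exterior K n).
Implicit Types (us : seq {set 'I_n}).

Lemma evar_in_evar_ideal (T : {set 'I_n}) k : (evar K k \in evar_ideal K T) = (k \in T).
Proof.
apply/mem_evar_ideal/idP => [/(_ [set k]%SET)|kT A].
  rewrite ecoef_ebasis eqxx oner_neq0 disjoints1 negbK; exact.
rewrite ecoef_ebasis; have [->|_] := eqVneq A [set k]%SET; last by rewrite eqxx.
by rewrite disjoints1 kT.
Qed.

Lemma mem_prefix_colon us pre U post x : uniq us -> us = pre ++ U :: post ->
  (x \in prefix_colon K us U) = (x * emono K U \in mono_ideal K pre).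
Proof.
move=> us_uniq e; have nU : U \notin pre.
  by move: us_uniq; rewrite e cat_uniq /= negb_or => /and3P[_ /andP[]].
rewrite /prefix_colon /colon -memv_preim lfunE /= {1}e index_cat (negPf nU) /=.
by rewrite eqxx addn0 e take_size_cat.
Qed.

(** A set T of variables generating the colon ideal must be set(U), because the ideal (T) contains
    no variables outside T. *)
Lemma linear_quotients_chain us : uniq us -> linear_quotients K us ->
  colon_chain K (lq_set K us) us.
Proof.
move=> us_uniq lin_us pre U post e x; rewrite -(mem_prefix_colon _ us_uniq e).
have [|T eT] := lin_us U; first by rewrite e mem_cat inE eqxx orbT.
suff -> : lq_set K us U = T by rewrite eT.
by apply/setP => k; rewrite inE eT evar_in_evar_ideal.
Qed.

(** e_k e_U = 0 for k in U. Hence set(U) is nonempty for U nonempty, as the growth estimates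
    require. *)
Lemma support_sub_lq_set us U : uniq us -> U \in us -> U \subset lq_set K us U.
Proof.
move=> us_uniq /splitPr e; case: e us_uniq => pre post us_uniq.
apply/fintype.subsetP => k kU; rewrite inE (mem_prefix_colon _ us_uniq erefl).
by rewrite emonoE ebasisM disjoints1 kU mem0v.
Qed.

End LinearQuotients.

Theorem corollary3p6 (R : realType) (K : fieldType) (n : nat)
    (I : ideal K n) (G : {set {set 'I_n}}) (us : seq {set 'I_n})
    (I_neq0 : (I : {vspace exterior K n}) != 0%VS)
    (I_proper : (I : {vspace exterior K n}) != fullv)
    (I_monomial : is_monomial_ideal I)
    (G_gens : min_mono_gens I G)
    (us_order : perm_eq us (enum G))
    (us_deg : degree_increasing us)
    (us_lin : linear_quotients K us) :
  cx R (equot I) = ((\max_(u in G) #|lq_set K us u|)%:R)%:E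
  /\ (infinite_set [set: K]%classic ->
      depth (equot I) = \big[minn/n]_(u in G) (n - #|lq_set K us u|)%N).
Proof.
set S := lq_set K us.
have us_uniq : uniq us by rewrite (perm_uniq us_order) enum_uniq.
have us_G U : (U \in us) = (U \in G) by rewrite (perm_mem us_order) mem_enum.
have eI : (I : {vspace exterior K n}) = mono_ideal K us.
  rewrite -(eqP (minsetp G_gens)) /mono_ideal /ideal_gen.
  by congr (_ * _ * _)%VS; apply: eq_span; apply/perm_mem/perm_map; rewrite perm_sym.
have ch := linear_quotients_chain us_uniq us_lin.
(* A generator with empty support is 1 and would make I the whole algebra. *)
have us0 : finset.set0 \notin us.
  apply: contraNN I_proper => us0; rewrite eqEsubv subvf /=; apply/subvP => x _.
  rewrite eI; apply/mem_mono_ideal => A _; apply/hasP.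
  by exists finset.set0; rewrite ?finset.sub0set.
have S_gt0 U : U \in us -> (0 < #|S U|)%N.
  move=> Uus; apply: leq_trans (subset_leq_card (support_sub_lq_set K us_uniq Uus)).
  by rewrite card_gt0; apply: contraNneq us0 => <-.
(* The maximum is attained since G is nonempty, I being nonzero. *)
have [U0 U0G eU0] : {U0 | U0 \in G & \max_(u in G) #|S u| = #|S U0|}.
  apply: eq_bigmax_cond; rewrite lt0n; apply: contraNneq I_neq0.
  move=> /card0_eq G0; rewrite eI.
  suff -> : us = [::] by rewrite mono_ideal_nil.
  by move: us_G; case: (us) => // U us' /(_ U); rewrite G0 inE eqxx.
have le_U0 U : U \in us -> (#|S U| <= #|S U0|)%N.
  by rewrite us_G => UG; rewrite -eU0 leq_bigmax_cond.
have U0us : U0 \in us by rewrite us_G.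
have le_n U : (#|S U| <= n)%N by rewrite -[X in (_ <= X)%N]card_ord max_card.
split; last first.
  (* The map m -> n - m turns the maximum into the minimum, and the default 0 into n. *)
  move=> infK; have -> : \big[minn/n]_(u in G) (n - #|S u|)%N = (n - #|S U0|)%N.
    rewrite -eU0 (big_morph (fun m => n - m)%N (id1 := n) (op1 := minn)) ?subn0 //.
    by move=> a b; lia.
  apply: (depth_chain eI ch us_deg us0 (infinite_avoid infK)).
    by move=> U /le_U0; have := le_n U0; rewrite -/S; lia.
  by exists U0 => //; rewrite subnKC.
have [F [rF gF eF]] := chain_resolution (d := n) ch us_deg us0
  (fun U _ => leq_trans (max_card _) (eq_leq (card_ord n))).
rewrite -eI in rF.
have bettiE i : betti (equot I) i.+1 = (\sum_(U <- us) 'C((i + #|S U|).-1, i))%N.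
  by rewrite (betti_quotient rF i gF) eF.
rewrite /cx eU0 -(prednK (S_gt0 _ U0us)).
(* From above, each of the [size us] binomials is bounded with the largest exponent; from below,
   only the summand of [U0] is kept, and the factorial clears its denominator. *)
apply: (@polynomial_growth _ _ _ (size us * n ^ #|S U0|.-1) (#|S U0|.-1)`!) => i.
  rewrite bettiE -mulnA -expnMn mulnC.
  rewrite -[X in (_ <= X)%N]iter_addn_0 -(count_predT us) -big_const_seq.
  rewrite big_seq [X in (_ <= X)%N]big_seq; apply: leq_sum => U Uus.
  have n0 : (0 < n)%N by apply: leq_trans (S_gt0 _ Uus) (le_n U).
  apply: leq_trans (bin_le_expn i (n := n) _) _; first by rewrite S_gt0 ?le_n.
  rewrite leq_pexp2l ?muln_gt0 ?n0 //.
  by have := le_U0 U Uus; have := S_gt0 U Uus; lia.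
apply: leq_trans (expn_le_bin i (S_gt0 _ U0us)) _.
by rewrite bettiE leq_mul2l (bigD1_seq U0) //= leq_addr orbT.
Qed.
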